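(* Let $G$ be a finitely generated virtually free group and $\varphi\in \mathrm{End}(G)$. There is a computable constant $k$ (i.e. there is an algorithm which, given $G$ and $\varphi$, outputs a natural number $k$) such that $$\max\{|\mathrm{Orb}_\varphi(x)| \mid x\in \mathrm{EvPer}(\varphi)\}\leq k.$$
   Context: Maps are written on the right. For $x\in G$, $\mathrm{Orb}_\varphi(x)=\{x\varphi^j\mid j\geq 0\}$. $\mathrm{EvPer}(\varphi)$ is the set of eventually periodic points of $\varphi$, i.e. the set of $x\in G$ whose orbit $\mathrm{Orb}_\varphi(x)$ is finite (equivalently, some $x\varphi^m$ is a periodic point, i.e. a point $y$ with $y\varphi^p=y$ for some $p\geq 1$). Input convention: a finitely generated virtually free group $G$ is given as input by a decomposition as a disjoint union $G=Fb_1\cup\cdots\cup Fb_m$, where $F=F_A\trianglelefteq G$ is a free group on a finite set $A$, together with a presentation $\langle A,b_1,\ldots,b_m\mid R\rangle$ of $G$ in which the relations in $R$ are of the form $b_ia=u_{ia}b_i$ and $b_ib_j=v_{ij}b_{r_{ij}}$, with $u_{ia},v_{ij}\in F_A$, $r_{ij}\in\{1,\ldots,m\}$; $\varphi$ is given by the images of the generators. *)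

(* Defs.v *)
From mathcomp Require Import all_boot.
From mathcomp Require Import boolp classical_sets functions cardinality.

Set Implicit Arguments.
Unset Strict Implicit.
Unset Printing Implicit Defensive.

Local Open Scope group_scope.
Local Open Scope classical_set_scope.
Local Open Scope card_scope.

(* Partial recursive functions of n natural arguments. *)
Inductive recfn : nat -> Type :=
| RZero : recfn 0
| RSucc : recfn 1
| RProj n (i : 'I_n) : recfn n
| RComp n k (f : recfn k) (g : 'I_k -> recfn n) : recfn n
| RPrec n (f : recfn n) (g : recfn n.+2) : recfn n.+1
| RMin n (f : recfn n.+1) : recfn n.

(* [computes c x y]: the function with code c is defined at x, with value y.
   In the case of primitive recursion, s lists the successive values. *)
Fixpoint computes n (c : recfn n) : n.-tuple nat -> nat -> Prop :=
  match c in recfn n return n.-tuple nat -> nat -> Prop with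
  | RZero => fun _ y => y = 0%N
  | RSucc => fun x y => y = (thead x).+1
  | RProj _ i => fun x y => y = tnth x i
  | RComp _ k f g => fun x y =>
      exists2 z : k.-tuple nat,
        forall j, computes (g j) x (tnth z j) & computes f z y
  | RPrec n f g => fun x y =>
      let x' : n.-tuple nat := [tuple of behead x] in
      exists s : nat -> nat,
        [/\ computes f x' (s 0%N),
            forall i, (i < thead x)%N ->
              computes g [tuple of i :: s i :: x'] (s i.+1)
          & y = s (thead x)]
  | RMin _ f => fun x y =>
      computes f [tuple of y :: x] 0%N /\
      forall z, (z < y)%N -> exists t, computes f [tuple of z :: x] t.+1
  end.

(* The letter (x, false) stands for x and (x, true) for its inverse. *)
Definition word (X : Type) := seq (X * bool).

Definition gen (X : Type) (x : X) : X * bool := (x, false).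

Definition reduced (X : eqType) (w : word X) : bool :=
  sorted (fun l l' : X * bool => l' != (l.1, ~~ l.2)) w.

Definition wval (G : groupType) (X : Type) (e : X -> G) (w : word X) : G :=
  \prod_(l <- w) (if l.2 then (e l.1)^-1 else e l.1).

Definition free_family (G : groupType) (X : eqType) (e : X -> G) : Prop :=
  forall w : word X, reduced w -> wval e w = 1 -> w = [::].

Definition spanned (G : groupType) (X : Type) (e : X -> G) : set G :=
  range (wval e).

Definition normal_set (G : groupType) (F : set G) : Prop :=
  forall g x : G, F x -> F (x ^ g).

(* Equality in the group < X | R > of the elements represented by two words. *)
Inductive pres_eq (X : Type) (R : word X -> word X -> Prop) :
  word X -> word X -> Prop :=
| pres_rel w w' : R w w' -> pres_eq R w w'
| pres_cancel (x : X) (b : bool) : pres_eq R [:: (x, b); (x, ~~ b)] [::]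
| pres_refl w : pres_eq R w w
| pres_sym w w' : pres_eq R w w' -> pres_eq R w' w
| pres_trans w1 w2 w3 : pres_eq R w1 w2 -> pres_eq R w2 w3 -> pres_eq R w1 w3
| pres_cat w1 w1' w2 w2' :
    pres_eq R w1 w1' -> pres_eq R w2 w2' -> pres_eq R (w1 ++ w2) (w1' ++ w2').

Definition presentation (G : groupType) (X : Type) (e : X -> G)
    (R : word X -> word X -> Prop) : Prop :=
  (forall g, exists w, wval e w = g) /\
  (forall w w', wval e w = wval e w' <-> pres_eq R w w').

(* The set A is 'I_n; the generators b_1, ..., b_m are indexed by 'I_m. *)
Record vf_data (n m : nat) := VFData {
  vf_u : 'I_m -> 'I_n -> word 'I_n;
  vf_v : 'I_m -> 'I_m -> word 'I_n;
  vf_r : 'I_m -> 'I_m -> 'I_m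
}.

Definition inA n m (w : word 'I_n) : word ('I_n + 'I_m) :=
  [seq (inl l.1, l.2) | l <- w].

(* The relations b_i a = u_ia b_i and b_i b_j = v_ij b_(r_ij). *)
Inductive vf_rel n m (D : vf_data n m) :
  word ('I_n + 'I_m) -> word ('I_n + 'I_m) -> Prop :=
| vf_rel_ba i a :
    vf_rel D [:: gen (inr i); gen (inl a)]
             (inA m (vf_u D i a) ++ [:: gen (inr i)])
| vf_rel_bb i j :
    vf_rel D [:: gen (inr i); gen (inr j)]
             (inA m (vf_v D i j) ++ [:: gen (inr (vf_r D i j))]).

Definition gens (G : Type) n m (alpha : 'I_n -> G) (beta : 'I_m -> G)
    (x : 'I_n + 'I_m) : G :=
  match x with inl a => alpha a | inr i => beta i end.

(* G, with generators alpha (for A) and beta, is the virtually free group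
   described by D; the first four clauses say that F_A is a free normal
   subgroup and that G is the disjoint union of the cosets F_A b_i. *)
Record describes n m (D : vf_data n m) (G : groupType)
    (alpha : 'I_n -> G) (beta : 'I_m -> G) : Prop := Describes {
  desc_free : free_family alpha;
  desc_normal : normal_set (spanned alpha);
  desc_cover : \bigcup_i [set f * beta i | f in spanned alpha] = [set: G];
  desc_disjoint :
    trivIset [set: 'I_m] (fun i => [set f * beta i | f in spanned alpha]);
  desc_pres : presentation (gens alpha beta) (vf_rel D)
}.

(* An endomorphism is given by words for the images of the generators. *)
Definition endo_data (n m : nat) := 'I_n + 'I_m -> word ('I_n + 'I_m).

Definition describes_endo n m (E : endo_data n m) (G : groupType)
    (alpha : 'I_n -> G) (beta : 'I_m -> G) (phi : {multiplicative G -> G}) :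
    Prop :=
  forall x, phi (gens alpha beta x) = wval (gens alpha beta) (E x).

(* The input of an algorithm: n, m, and Goedel numbers (by [pickle], which is
   effective on these types) of the tables of u, v, r and of the images of the
   generators. *)
Definition input n m (D : vf_data n m) (E : endo_data n m) : 7.-tuple nat :=
  [tuple n; m;
    pickle [seq [seq vf_u D i a | a <- enum 'I_n] | i <- enum 'I_m];
    pickle [seq [seq vf_v D i j | j <- enum 'I_m] | i <- enum 'I_m];
    pickle [seq [seq vf_r D i j | j <- enum 'I_m] | i <- enum 'I_m];
    pickle [seq E (inl a) | a <- enum 'I_n];
    pickle [seq E (inr i) | i <- enum 'I_m]].

Definition Orb (T : Type) (phi : T -> T) (x : T) : set T :=
  range (fun j => iter j phi x).

Definition EvPer (T : Type) (phi : T -> T) : set T :=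
  [set x | finite_set (Orb phi x)].

(* M = max {|Orb_phi(x)| : x in EvPer(phi)}; recall `I_M = {0, ..., M - 1}. *)
Definition is_max_orbit (T : Type) (phi : T -> T) (M : nat) : Prop :=
  (exists2 x, EvPer phi x & Orb phi x #= `I_M) /\
  (forall x, EvPer phi x -> Orb phi x #<= `I_M).

(* Main.v *)
Require Import Defs.
From mathcomp Require Import all_boot all_order all_algebra.
From mathcomp Require Import boolp classical_sets functions cardinality.
From mathcomp Require Import zify ring.

(** The bound is an explicit function of [n] and [m], built from sums,
products, powers and factorials; that it is computable is then immediate, and
the substance is a uniform bound on orbits.

Let [F] be the free normal subgroup and let [H] be the set of the [g] all of
whose iterates [phi^i g] lie in [F]. It is a [phi]-invariant subgroup of [F].
The map sending [x] to the coset of [phi^i x] modulo [F] is determined by its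
values at the [n + m] generators, so there are at most [m ^ (n + m)] such
maps; hence [H] has bounded index, and Schreier's argument yields a bounded
number [d] of generators of [H] ([coset_iterates], [generators_exist]).

Periods. Let [p] be a prime and [k] a ring of characteristic [p]. Say that
[f : G -> k] has degree less than [c] when all its [c]-fold differences along
[H] vanish. Modulo the congruence [deg1_eq] on [H], which top degree terms do
not see, [H] is a finite elementary abelian [p]-group of rank at most [d]; so
for [L] a large enough factorial, [psi = phi^L] is idempotent on that quotient
and on the cosets of [H]. Then [f |-> f o psi^2 - f o psi] lowers degrees, and
raising this operator to the power [p ^ a >= c] by Frobenius gives
[f o psi^(2 p^a) = f o psi^(p^a)] whenever [f] has degree less than [c]
([degree_lt_frobenius]). Such functions separate the points of [G], because
[F] embeds in a group of matrices over [F_p[s][t]] that are the identity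
modulo [t] ([degree_lt_separation]). Therefore the [psi]-period of a periodic
point is a power of [p]; taking [p = 2] and [p = 3], it is [1]
([periodic_period]).

Preperiods. The homomorphisms from [H] to [SL2(Q)], with the matrix entries
of the [d] generators as coordinates, form an irreducible variety: being a
subgroup of a free group, [H] has its representations parametrized by labels
in [SL2(Q)] on the edges of the coset graph of [H] in [F], and two elements of
[SL2(Q)] are joined by a polynomial path because each is a product of four
elementary matrices ([rep_path]). Composition with [phi] is a polynomial
self-map of this variety, so the functions that vanish on its successive
images form an increasing chain of prime ideals, constant as soon as two
consecutive ones agree. A function in one ideal but not in the previous one
can be picked at each strict step, and these functions are algebraically
independent; since there are only [4 d] coordinates, the chain is constant
from [4 d] on ([vanish_stable]). Representations separate the points of [H],
so an element of [H] killed by some iterate of [phi] is killed by [phi^(4 d)]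
([kernel_stable]).

Conclusion. If [x] is eventually periodic, then [psi] fixes some [phi^j x].
The quotient of [psi (psi x)] by [psi x] lies in [H] and is killed by [phi^j],
hence by [phi^(4 d)], that is, [phi^(4 d + 2 L) x = phi^(4 d + L) x]. *)

Set Implicit Arguments.
Unset Strict Implicit.
Unset Printing Implicit Defensive.
Import Order.TTheory GRing.Theory Num.Theory.

(** * Arithmetic computable functions *)

Definition computable n (f : n.-tuple nat -> nat) : Prop :=
  exists c : recfn n, forall x, computes c x (f x).

Lemma computable_proj n (i : 'I_n) : computable (fun x => tnth x i).
Proof. by exists (RProj i). Qed.

Lemma computable_comp n k (f : k.-tuple nat -> nat)
    (g : 'I_k -> n.-tuple nat -> nat) :
  computable f -> (forall j, computable (g j)) ->
  computable (fun x => f [tuple g j x | j < k]).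
Proof.
move=> [c fc] /choice[d gd]; exists (RComp c d) => x /=.
by exists [tuple g j x | j < k] => // j; rewrite tnth_mktuple.
Qed.

Lemma computable_succ n (f : n.-tuple nat -> nat) :
  computable f -> computable (fun x => (f x).+1).
Proof.
move=> fc; have Sc : computable (fun x : 1.-tuple nat => (thead x).+1).
  by exists RSucc.
have := computable_comp Sc (fun _ : 'I_1 => fc).
by move=> [c cP]; exists c => x; have := cP x; rewrite /thead tnth_mktuple.
Qed.

Lemma computable_cst n (k : nat) : computable (fun _ : n.-tuple nat => k).
Proof.
elim: k => [|k IHk]; last exact: computable_succ.
have zc : computable (fun _ : 0.-tuple nat => 0) by exists RZero.
have gc (j : 'I_0) : @computable n (fun _ => 0) by case: j.
exact: (computable_comp zc gc).
Qed.

Definition computable2 (op : nat -> nat -> nat) : Prop :=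
  computable (fun x : 2.-tuple nat => op (tnth x ord0) (tnth x (lift ord0 ord0))).

Lemma computable_op n op (f g : n.-tuple nat -> nat) :
  computable2 op -> computable f -> computable g ->
  computable (fun x => op (f x) (g x)).
Proof.
move=> opc fc gc.
have h (j : 'I_2) : computable (if j == ord0 then f else g) by case: ifP.
have [c cP] := computable_comp opc h; exists c => x.
by have := cP x; rewrite !tnth_mktuple.
Qed.

(** Primitive recursion on the first argument; the step function receives the
counter, the previous value and the second argument. *)
Lemma computable2_rec op (step : 3.-tuple nat -> nat) :
  computable (fun x : 1.-tuple nat => op 0 (thead x)) -> computable step ->
  (forall i y, op i.+1 y = step [tuple i; op i y; y]) -> computable2 op.
Proof.
move=> [c0 c0P] [c1 c1P] opS; exists (RPrec c0 c1) => x /=.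
exists (fun i => op i (tnth x (lift ord0 ord0))).
case/tupleP: x => a x; case/tupleP: x => b x.
split=> [|i _|]; last by rewrite /thead.
- have -> : tnth [tuple of a :: [tuple of b :: x]] (lift ord0 ord0) =
            thead [tuple of behead [tuple of a :: [tuple of b :: x]]].
    by rewrite /thead !(tnth_nth 0).
  exact: c0P.
- rewrite (tuple0 x) (tnth_nth 0)/= opS.
  have -> : [tuple of i :: op i b :: [tuple of behead [:: a, b & [tuple]]]] =
            [tuple i; op i b; b] by apply/val_inj.
  exact: c1P.
Qed.

Lemma computable2_add : computable2 addn.
Proof.
apply: (computable2_rec (step := fun x => (tnth x (lift ord0 ord0)).+1)) => //.
- exact: (computable_proj ord0).
- exact/computable_succ/computable_proj.
Qed.

Lemma computable2_mul : computable2 muln.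
Proof.
apply: (computable2_rec (step := fun x => tnth x ord_max + tnth x (lift ord0 ord0))).
- exact: computable_cst.
- apply: computable_op computable2_add _ _; exact: computable_proj.
- by move=> i y; rewrite mulSn !(tnth_nth 0).
Qed.

Lemma computable2_expr : computable2 (fun e b => b ^ e).
Proof.
apply: (computable2_rec (step := fun x => tnth x ord_max * tnth x (lift ord0 ord0))).
- exact: computable_cst.
- apply: computable_op computable2_mul _ _; exact: computable_proj.
- by move=> i y; rewrite expnS !(tnth_nth 0).
Qed.

Lemma computable2_fact : computable2 (fun b _ => b`!).
Proof.
apply: (computable2_rec (step := fun x => (tnth x ord0).+1 * tnth x (lift ord0 ord0))).
- exact: computable_cst.
- apply: computable_op computable2_mul _ _; first apply: computable_succ.
    exact: computable_proj.
  exact: computable_proj.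
- by move=> i y; rewrite factS !(tnth_nth 0).
Qed.

Lemma computableD n (f g : n.-tuple nat -> nat) :
  computable f -> computable g -> computable (fun x => f x + g x).
Proof. exact: computable_op computable2_add. Qed.

Lemma computableM n (f g : n.-tuple nat -> nat) :
  computable f -> computable g -> computable (fun x => f x * g x).
Proof. exact: computable_op computable2_mul. Qed.

Lemma computableX n (f g : n.-tuple nat -> nat) :
  computable f -> computable g -> computable (fun x => f x ^ g x).
Proof. by move=> fc gc; apply: (computable_op computable2_expr gc fc). Qed.

Lemma computable_fact n (f : n.-tuple nat -> nat) :
  computable f -> computable (fun x => (f x)`!).
Proof. by move=> fc; apply: (computable_op computable2_fact fc fc). Qed.

(** * Orbits of a self-map *)

Section Orbits.
Local Open Scope classical_set_scope.
Local Open Scope card_scope.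
Variables (T : Type) (f : T -> T).

(** A finite orbit cannot be enumerated injectively by the natural numbers. *)
Lemma EvPer_collision x : EvPer f x ->
  exists j r, 0 < r /\ iter (j + r) f x = iter j f x.
Proof.
move=> fin; apply: contrapT => no.
have inj : injective (fun j => iter j f x).
  move=> i j; wlog ij : i j / i <= j.
    by move=> W e; case: (leqP i j) => [/W|/ltnW/W]; [apply|move/(_ (esym e))].
  move=> e; apply/eqP; rewrite eqn_leq ij /= leqNgt; apply/negP => lij.
  by apply: no; exists i, (j - i); rewrite subn_gt0 subnKC // ltnW.
have [c cE] := fin; have : `I_c.+1 #<= `I_c; last by rewrite card_le_II ltnn.
rewrite -(card_le_eqr cE); apply: card_le_trans (subset_card_le (@subsetT _ _)) _.
by rewrite -(card_le_eql (inj_card_eq (in2W inj))).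
Qed.

Lemma card_Orb_le x a r : 0 < r -> iter (a + r) f x = iter a f x ->
  Orb f x #<= `I_(a + r).
Proof.
move=> r0 e; apply: card_le_trans (card_image_le (fun j => iter j f x) `I_(a + r)).
apply: subset_card_le => _ [j _ <-].
have [i] := ubnP j; elim: i j => // i IHi j ji.
case: (ltnP j (a + r)) => [lj|aj]; first by exists j.
have -> : iter j f x = iter (j - r) f x.
  have -> : j = (j - (a + r)) + (a + r) by rewrite subnK.
  by rewrite iterD e -iterD; congr (iter _ f x); lia.
by apply: IHi; lia.
Qed.

Lemma is_max_orbit_exists k x0 : f x0 = x0 ->
  (forall x, EvPer f x -> Orb f x #<= `I_k) ->
  exists2 M, is_max_orbit f M & M <= k.
Proof.
move=> fx0 bound.
pose P c := `[< exists2 x, EvPer f x & Orb f x #= `I_c >].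
have Pk c : P c -> c <= k.
  by move=> /asboolP[x /bound xk cE]; rewrite -card_le_II -(card_le_eql cE).
have x0fin : EvPer f x0.
  apply: card_le_finite (finite_II 1).
  by apply: (@card_Orb_le x0 0 1).
have exP : exists c, P c.
  by have [c cE] := x0fin; exists c; apply/asboolP; exists x0.
case: (ex_maxnP exP Pk) => M /asboolP PM Mmax; exists M; last exact/Pk/asboolP.
split=> // x xfin; have [c cE] := xfin.
rewrite (card_le_eql cE) card_le_II; apply: Mmax; apply/asboolP; by exists x.
Qed.

End Orbits.

(** A sequence taking finitely many values, in which the class of the next term
depends only on that of the current one, is eventually periodic with preperiod
and period at most [B]. As [B`!] is at least [B] and a multiple of every
possible period, it serves for both at once. With [j = 0] this says that the
[B`!]-th iterate is idempotent. *)
Lemma shift_pigeonhole (T : finType) (code : nat -> T) (R : nat -> nat -> Prop)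
    (B : nat) :
  (forall i j k, R i j -> R j k -> R i k) ->
  (forall i j, R i j -> R i.+1 j.+1) ->
  (forall i j, code i = code j -> R i j) ->
  (#|T| <= B)%N -> forall j, R (B`! + j)%N (B`! + (B`! + j))%N.
Proof.
move=> R_trans R_shift codeR TB.
have shift i j k : R i j -> R (i + k)%N (j + k)%N.
  by move=> Rij; elim: k => [|k]; rewrite ?addn0 // !addnS; apply: R_shift.
have [i [i' [ii' i'B /codeR Ri]]] :
    exists i i', [/\ (i < i')%N, (i' <= #|T|)%N & code i = code i'].
  have /injectivePn[i [j]] : ~~ injectiveb (fun i : 'I_(#|T|).+1 => code i).
    apply/negP => /injectiveP/leq_card; by rewrite card_ord ltnn.
  wlog ij : i j / (i < j)%N.
    move=> W ne e; have := ne; rewrite -val_eqE neq_ltn => /orP[ij|ji].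
      exact: (W i j).
    by apply: (W j i) => //; rewrite eq_sym.
  by move=> _ e; exists i, j; split=> //; rewrite -ltnS.
have [d d_def] : exists d, d = (i' - i)%N by exists (i' - i)%N.
have i'E : i' = (i + d)%N by rewrite d_def subnKC // ltnW.
have Rm a m : R (i + a)%N (i + a + m * d)%N.
  elim: m => [|m IHm]; first by rewrite mul0n addn0; apply: codeR.
  apply: R_trans IHm _.
  have := shift _ _ (a + m * d)%N Ri; rewrite addnA.
  by have -> : (i' + (a + m * d) = i + a + m.+1 * d)%N by rewrite i'E mulSn; lia.
have /dvdnP[m mE] : d %| B`! by apply: dvdn_fact; lia.
have iB : (i <= B`!)%N by apply: leq_trans (fact_geq B); lia.
move=> j; have := Rm (B`! - i + j)%N m; rewrite -mE.
have -> : (i + (B`! - i + j) = B`! + j)%N by lia.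
by rewrite [X in R _ X]addnC.
Qed.

Lemma morph_mulg1 (G : groupType) (f : G -> G) :
  {morph f : x y / (x * y)%g} -> f 1%g = 1%g.
Proof. by move=> fM; apply: (@mulIg _ (f 1%g)); rewrite -fM !mul1g. Qed.

(** * Words in a free group *)

Section FreeWords.
Variables (G : groupType) (X : eqType) (e : X -> G).
Implicit Types (w : word X) (l : X * bool).

Definition inv_letter l : X * bool := (l.1, ~~ l.2).

Lemma inv_letterK : involutive inv_letter.
Proof. by case=> x b; rewrite /inv_letter negbK. Qed.

Definition inv_word w : word X := rev (map inv_letter w).

Lemma wval_nil : wval e [::] = 1%g.
Proof. exact: big_nil. Qed.

Lemma wval_cons l w :
  wval e (l :: w) = ((if l.2 then (e l.1)^-1 else e l.1) * wval e w)%g.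
Proof. exact: big_cons. Qed.

Lemma wval_cat w w' : wval e (w ++ w') = (wval e w * wval e w')%g.
Proof. exact: big_cat. Qed.

Lemma wval_letterV l : wval e [:: inv_letter l] = (wval e [:: l])^-1%g.
Proof.
by rewrite !wval_cons wval_nil !mulg1; case: l => x [] //=; rewrite invgK.
Qed.

Lemma wval_inv_word w : wval e (inv_word w) = (wval e w)^-1%g.
Proof.
elim: w => [|l w IHw]; first by rewrite wval_nil invg1.
rewrite /inv_word /= rev_cons -cats1 wval_cat [wval e (rev _)]IHw.
by rewrite wval_letterV -invgM -wval_cat.
Qed.

Lemma nreducedP w : ~~ reduced w ->
  exists u l v, w = u ++ l :: inv_letter l :: v.
Proof.
elim: w => // l [|l' w] // IHw; rewrite /reduced /= negb_and negbK.
case/orP => [/eqP ->|/IHw[u [l1 [v ->]]]]; first by exists [::], l, w.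
by exists (l :: u), l1, v.
Qed.

(** The universal property of a free family, in the form used below: a quantity
attached to words that does not see the insertion of cancelling pairs depends
only on the group element. Inserting [inv_word w' ++ w'] after [w] reduces the
claim to words of value [1], and such a word, unless empty, is not reduced. *)
Lemma free_family_invariant (T : Type) (Th : word X -> T) :
  free_family e ->
  (forall u l v, Th (u ++ l :: inv_letter l :: v) = Th (u ++ v)) ->
  forall w w', wval e w = wval e w' -> Th w = Th w'.
Proof.
move=> e_free Th_cancel.
have Th_one n w s : size w <= n -> wval e w = 1%g -> Th (w ++ s) = Th s.
  elim: n w => [|n IHn] w; first by rewrite leqn0 size_eq0 => /eqP ->.
  case: (boolP (reduced w)) => [wred _ /(e_free w wred)-> //|].
  case/nreducedP => u [l [v ->]] sz w1; rewrite -catA Th_cancel catA IHn //.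
    by move: sz; rewrite !size_cat /=; lia.
  move: w1; rewrite !wval_cat -cat1s -[inv_letter l :: v]cat1s !wval_cat.
  by rewrite wval_letterV mulVKg.
have Th_inv u w : Th (u ++ inv_word w ++ w) = Th u.
  elim: w u => [|l w IHw] u; first by rewrite !cats0.
  rewrite /inv_word /= rev_cons -cats1 -!catA /= -{2}(inv_letterK l) catA.
  by rewrite Th_cancel -catA; apply: IHw.
move=> w w' ww'; rewrite -(Th_inv w w') catA.
by apply: (Th_one _ _ _ (leqnn _)); rewrite wval_cat wval_inv_word ww' mulgV.
Qed.

End FreeWords.

(** * A free family of matrices of determinant one *)

Section SL2.
Local Open Scope ring_scope.

Definition mx2 (R : nzRingType) (a b c d : R) : 'M[R]_2 :=
  \matrix_(i, j) if i == 0 then (if j == 0 then a else b)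
                 else (if j == 0 then c else d).

Lemma ord2P (i : 'I_2) : i = 0 \/ i = 1.
Proof. by case: i => [[|[|//]]] h; [left|right]; apply/val_inj. Qed.

Lemma mx2_eqP (R : nzRingType) (A B : 'M[R]_2) :
  A 0 0 = B 0 0 -> A 0 1 = B 0 1 -> A 1 0 = B 1 0 -> A 1 1 = B 1 1 -> A = B.
Proof.
by move=> *; apply/matrixP => i j; case: (ord2P i) => ->; case: (ord2P j) => ->.
Qed.

Lemma mx2E (R : nzRingType) (A : 'M[R]_2) : A = mx2 (A 0 0) (A 0 1) (A 1 0) (A 1 1).
Proof. by apply: mx2_eqP; rewrite !mxE. Qed.

Lemma mx2M (R : nzRingType) (a b c d a' b' c' d' : R) :
  mx2 a b c d * mx2 a' b' c' d' =
  mx2 (a * a' + b * c') (a * b' + b * d') (c * a' + d * c') (c * b' + d * d').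
Proof.
by apply: mx2_eqP; rewrite !mxE !big_ord_recl big_ord0 !mxE addr0.
Qed.

Lemma mx2_1 (R : nzRingType) : 1 = mx2 1 0 0 1 :> 'M[R]_2.
Proof. by apply: mx2_eqP; rewrite !mxE. Qed.

Lemma det_mx2E (R : comNzRingType) (a b c d : R) :
  \det (mx2 a b c d) = a * d - b * c.
Proof.
rewrite (expand_det_row _ 0) !big_ord_recl big_ord0 /cofactor !det_mx11 !mxE /=.
by rewrite expr0 expr1; ring.
Qed.

Section Letters.
Variables (k : idomainType) (n : nat) (c : 'I_n -> k).

(** Divided by the square of its parameter, the matrix of the letter [l] tends to
the projection on the line spanned by [(1, slope l)], along the line of the
inverse letter. *)
Definition slope (l : 'I_n * bool) : k := c l.1 + l.2%:R.

(** With [P] that projection and [S] the involution exchanging the two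
lines, this is [1 + X^2 P + X S] for a generator, and [1 + X^2 P - X S] for an
inverse. It is a conjugate, by a constant matrix, of the hyperbolic matrix with
rows [(1 + X^2, X)] and [(X, 1)], or of its inverse. Having the form [1 + X M]
serves residual finiteness at [p]; having determinant [1] and polynomial
entries serves specialization at rational parameters. *)
Definition letter_mx (l : 'I_n * bool) : 'M[{poly k}]_2 :=
  let s := (-1) ^+ l.2 in
  let u := (slope l)%:P in let v := (slope (inv_letter l))%:P in
  mx2 (1 + s * ('X^2 * v + 'X)) (- s * 'X^2)
      (s * ('X^2 * u * v + 'X * (2 * (c l.1)%:P + 1))) (1 - s * ('X^2 * u + 'X)).

Lemma letter_mxV l : letter_mx l * letter_mx (inv_letter l) = 1.
Proof.
case: l => i []; rewrite /letter_mx /slope /= ?addr0 mx2M mx2_1;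
by congr mx2; rewrite ?polyCD ?expr0 ?expr1; ring.
Qed.

Lemma det_letter_mx l : \det (letter_mx l) = 1.
Proof.
case: l => i []; rewrite /letter_mx /slope /= ?addr0 det_mx2E;
by rewrite ?polyCD ?expr0 ?expr1; ring.
Qed.

Lemma letter_mx_mod l : exists M, letter_mx l = 1 + 'X *: M.
Proof.
exists (let s := (-1) ^+ l.2 in
  let u := (slope l)%:P in let v := (slope (inv_letter l))%:P in
  mx2 (s * ('X * v + 1)) (- s * 'X)
      (s * ('X * u * v + (2 * (c l.1)%:P + 1))) (- s * ('X * u + 1))).
apply: mx2_eqP; rewrite !mxE /=; ring.
Qed.

Hypothesis slope_inj : injective slope.

Definition word_mx (w : word 'I_n) : 'M[{poly k}]_2 := \prod_(l <- w) letter_mx l.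

(** Ping-pong on leading coefficients: each letter of a reduced word raises the
degree of the vector by exactly two, because its projection kills only the line
of the inverse letter, which is not the line that the rest of the word leads
to. *)
Lemma word_mx_leading w l0 : reduced (rcons w l0) ->
  let x := word_mx w 0 0 + word_mx w 0 1 * (slope l0)%:P in
  let y := word_mx w 1 0 + word_mx w 1 1 * (slope l0)%:P in
  exists2 a, a != 0 &
    [/\ (size x <= (2 * size w).+1)%N, (size y <= (2 * size w).+1)%N,
        x`_(2 * size w) = a & y`_(2 * size w) = a * slope (head l0 w)].
Proof.
elim: w => [|l w IHw] w_red.
  exists 1; first exact: oner_neq0.
  rewrite /word_mx big_nil mx2_1 !mxE /= mul0r addr0 !mul1r add0r muln0 coef1 coefC.
  by rewrite size_poly1 size_polyC; split=> //; case: eqP.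
have /IHw[a a0 [sx sy xa ya]] : reduced (rcons w l0).
  by move: w_red; rewrite /reduced /=; apply: path_sorted.
have ll' : slope (inv_letter l) - slope (head l0 w) != 0.
  rewrite subr_eq0 (inj_eq slope_inj) eq_sym.
  by move: w_red; rewrite /reduced; case: (w) => [|l1 w1] /= /andP[].
set x0 := word_mx w 0 0 + _ in sx xa; set y0 := word_mx w 1 0 + _ in sy ya.
pose s : k := (-1) ^+ l.2.
have s0 : s != 0 by rewrite /s signr_eq0.
pose v := slope (inv_letter l); pose u := slope l.
have x1E : word_mx (l :: w) 0 0 + word_mx (l :: w) 0 1 * (slope l0)%:P =
   x0 + 'X * (s *: x0) + 'X^2 * (s *: (v *: x0 - y0)).
  rewrite /word_mx big_cons -/(word_mx w) (mx2E (word_mx w)) /letter_mx mx2M !mxE /=.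
  rewrite -!mul_polyC /s -/v /x0 /y0 rmorphXn /= rmorphN1; ring.
have cE : (2 * c l.1 + 1)%:P = 2 * (c l.1)%:P + 1.
  by rewrite polyCD polyCM polyC1 polyC_natr.
have y1E : word_mx (l :: w) 1 0 + word_mx (l :: w) 1 1 * (slope l0)%:P =
   y0 + 'X * (s *: ((2 * c l.1 + 1) *: x0 - y0)) +
   'X^2 * (s *: (u *: (v *: x0 - y0))).
  rewrite /word_mx big_cons -/(word_mx w) (mx2E (word_mx w)) /letter_mx mx2M !mxE /=.
  rewrite -!mul_polyC /s -/v -/u /x0 /y0 rmorphXn /= rmorphN1 cE.
  ring.
clearbody x0 y0.
have lt2 : (2 * size w < 2 * (size w).+1)%N by rewrite ltn_mul2l ltnS leqnn.
have coefX1 (P : {poly k}) : ('X * P)`_(2 * (size w).+1) = P`_(2 * size w).+1.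
  by rewrite coefXM mulnS.
have coefX2 (P : {poly k}) : ('X^2 * P)`_(2 * (size w).+1) = P`_(2 * size w).
  by rewrite coefXnM mulnS /= addKn.
pose low (P : {poly k}) := (size P <= (2 * size w).+1)%N.
have top0 (P : {poly k}) j : low P -> (2 * size w < j)%N -> P`_j = 0.
  by move=> sP lj; rewrite nth_default //; apply: leq_trans lj.
have sizeP (P Q R : {poly k}) : low P -> low Q -> low R ->
    (size (P + 'X * Q + 'X^2 * R)%R <= (2 * (size w).+1).+1)%N.
  move=> sP sQ sR; apply/leq_sizeP => j lj.
  rewrite !coefD coefXM coefXnM !top0 ?if_same ?addr0 //; lia.
have lowZ b (P : {poly k}) : low P -> low (b *: P).
  exact: leq_trans (size_scale_leq _ _).
have lowB b : low (b *: x0 - y0).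
  apply: leq_trans (size_polyD _ _) _.
  by rewrite size_polyN geq_max sy (leq_trans (size_scale_leq _ _) sx).
exists (s * ((v - slope (head l0 w)) * a)).
  by rewrite !mulf_neq0.
rewrite /= x1E y1E; split; try (by apply: sizeP;
  repeat first [exact: sx | exact: sy | exact: lowB | apply: (lowZ _ _ _)]).
- rewrite !coefD coefX1 coefX2 !coefZ coefB coefZ xa ya !(top0 x0) //.
  ring.
- rewrite !coefD coefX1 coefX2 !coefZ coefB !coefZ coefB coefZ xa ya.
  rewrite !(top0 x0) ?(top0 y0) //.
  rewrite /u; ring.
Qed.

(** Repeating the last letter keeps the word reduced, so its own line may be taken
as the starting vector. *)
Lemma word_mx_neq1 w : reduced w -> w <> [::] -> word_mx w <> 1.
Proof.
case: w => // l w w_red _ w1; pose l0 := last l w.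
have /word_mx_leading : reduced (rcons (l :: w) l0).
  rewrite /reduced /= rcons_path; apply/andP; split=> //=.
  by rewrite -/l0; case: (l0) => i b; rewrite xpair_eqE eqxx; case: b.
rewrite w1 mx2_1 !mxE /= mul0r addr0 mulnS coef1 => -[a /eqP a0 [_ _ /esym]].
by move/a0.
Qed.

End Letters.
End SL2.

(** * Coset representatives and Schreier generators *)

Section Schreier.
Local Open Scope group_scope.
Variables (G : groupType) (H : G -> Prop).
Variables (CT : finType) (col : G -> CT).
Hypothesis colP : forall x y, col x = col y <-> H (x / y).

(** The base coset must be represented by [1] itself, so that [schreier 1 h = h]
on the subgroup. *)
Definition coset_rep (t : CT) : G :=
  if t == col 1 then 1 else xget 1 [set x | col x = t]%classic.

Lemma col_rep g : col (coset_rep (col g)) = col g.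
Proof.
rewrite /coset_rep; case: eqP => [->//|_].
exact: (@xgetPex _ 1 [set x | col x = col g]%classic (ex_intro _ g erefl)).
Qed.

Lemma col_mulr x y g : col x = col y -> col (x * g) = col (y * g).
Proof. by move/colP => xy; apply/colP; rewrite mulgKA. Qed.

Lemma col_H h : H h -> col h = col 1.
Proof. by move=> Hh; apply/colP; rewrite divg1. Qed.

(** The element of the subgroup read along the edge, or the path, that leads from
the coset of [g] to that of [g * x]. *)
Definition schreier g x : G := coset_rep (col g) * x / coset_rep (col (g * x)).

Lemma schreierH g x : H (schreier g x).
Proof. by apply/colP; rewrite col_rep; apply/col_mulr/col_rep. Qed.

Lemma schreierM g x y : schreier g (x * y) = schreier g x * schreier (g * x) y.
Proof. by rewrite /schreier !mulgA mulgVK. Qed.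

Lemma schreier_col g g' x : col g = col g' -> schreier g x = schreier g' x.
Proof. by move=> e; rewrite /schreier (col_mulr x e) e. Qed.

Lemma schreier_g1 g : schreier g 1 = 1.
Proof. by rewrite /schreier !mulg1 mulgV. Qed.

Lemma schreier_1h h : H h -> schreier 1 h = h.
Proof.
by move=> Hh; rewrite /schreier mul1g col_H // /coset_rep eqxx mul1g divg1.
Qed.

Section Generators.
Variables (X : finType) (e : X -> G).
Hypothesis e_gen : forall g, exists w, wval e w = g.

Definition schreier_gen (tl : CT * (X * bool)) : G :=
  schreier (coset_rep tl.1) (wval e [:: tl.2]).

(** Reading a word letter by letter telescopes by [schreierM]. Letters and their
inverses are both listed, so products suffice. *)
Lemma schreier_generate h : H h ->
  exists w : seq (CT * (X * bool)), h = \prod_(j <- w) schreier_gen j.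
Proof.
have gen w g : exists s : seq (CT * (X * bool)),
    schreier g (wval e w) = \prod_(j <- s) schreier_gen j.
  elim: w g => [|l w IHw] g.
    by exists [::]; rewrite big_nil wval_nil schreier_g1.
  have [s sP] := IHw (g * wval e [:: l]).
  exists ((col g, l) :: s); rewrite -cat1s wval_cat schreierM sP big_cons.
  by congr (_ * _); apply: schreier_col; rewrite col_rep.
move=> Hh; have [w wh] := e_gen h; have [s sP] := gen w 1.
by exists s; rewrite -sP wh schreier_1h.
Qed.

End Generators.
End Schreier.

(** * Representations of a free group *)

Section FreeRepresentation.
Variables (G : groupType) (X : choiceType) (alpha : X -> G).
Hypothesis alpha_free : free_family alpha.

Definition word_of (x : G) : word X := xget [::] [set w | wval alpha w = x]%classic.

Lemma word_ofK x : spanned alpha x -> wval alpha (word_of x) = x.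
Proof.
case=> w _ wx.
exact: (@xgetPex _ [::] [set w | wval alpha w = x]%classic (ex_intro _ w wx)).
Qed.

Lemma spanned_reduced x : spanned alpha x ->
  exists2 w, reduced w & wval alpha w = x.
Proof.
case=> w _ <-; have [m] := ubnP (size w).
elim: m w => // m IHm w wm; case: (boolP (reduced w)) => [wred|]; first by exists w.
case/nreducedP => u [l [v wE]]; have [|r rred rE] := IHm (u ++ v).
  by move: wm; rewrite wE !size_cat /=; lia.
exists r => //; rewrite rE wE !wval_cat -cat1s -[inv_letter l :: v]cat1s !wval_cat.
by rewrite wval_letterV mulVKg.
Qed.

Section Representation.
Local Open Scope ring_scope.
Variables (S : nzRingType) (A : X * bool -> S).
Hypothesis AV : forall l, A l * A (inv_letter l) = 1.

Definition free_rep (x : G) : S := \prod_(l <- word_of x) A l.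

Lemma free_rep_wval w : free_rep (wval alpha w) = \prod_(l <- w) A l.
Proof.
apply: (free_family_invariant (Th := fun w => \prod_(l <- w) A l) alpha_free).
  by move=> u l v; rewrite !big_cat !big_cons /= (mulrA (A l)) AV mul1r.
by rewrite word_ofK //; exists w.
Qed.

Lemma free_rep1 : free_rep 1%g = 1.
Proof. by rewrite -(wval_nil alpha) free_rep_wval big_nil. Qed.

Lemma free_repM x y : spanned alpha x -> spanned alpha y ->
  free_rep (x * y)%g = free_rep x * free_rep y.
Proof.
by move=> [w _ <-] [w' _ <-]; rewrite -wval_cat !free_rep_wval big_cat.
Qed.

End Representation.
End FreeRepresentation.

(** It is enough to evaluate at a reduced word, which exists for every element. *)
Lemma letter_rep_faithful (G : groupType) (n : nat) (alpha : 'I_n -> G)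
    (k : idomainType) (c : 'I_n -> k) (x : G) :
  free_family alpha -> injective (slope c) -> spanned alpha x -> x <> 1%g ->
  free_rep alpha (letter_mx c) x <> 1%R.
Proof.
move=> alpha_free c_inj /spanned_reduced[w wred <-] w1.
rewrite free_rep_wval //; last exact: letter_mxV.
by apply: (word_mx_neq1 c_inj wred) => w0; apply: w1; rewrite w0 wval_nil.
Qed.

(** * Functions of finite degree and periods *)

Section PolynomialDegree.
Variables (G : groupType) (H : G -> Prop).
Hypothesis H1 : H 1%g.
Hypothesis HM : forall x y, H x -> H y -> H (x * y)%g.

Section Ring.
Local Open Scope ring_scope.
Variable k : comNzRingType.
Implicit Types (f : G -> k) (x y h : G) (c : nat).

Definition fdiff h f : G -> k := fun x => f (h * x)%g - f x.

(** Linear extensions of these [f] to the group ring are the forms that vanish on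
the [c]-th power of the augmentation ideal of [H]. *)
Fixpoint degree_lt c f : Prop :=
  if c is c'.+1 then forall h, H h -> degree_lt c' (fdiff h f)
  else forall x, f x = 0.

Lemma degree_lt_ext c f g : f =1 g -> degree_lt c f -> degree_lt c g.
Proof. by move=> fg; rewrite (funext fg). Qed.

Lemma degree_ltD c f g :
  degree_lt c f -> degree_lt c g -> degree_lt c (fun x => f x + g x).
Proof.
elim: c f g => [f g f0 g0 x|c IHc f g fc gc h Hh]; first by rewrite f0 g0 addr0.
apply: degree_lt_ext (IHc _ _ (fc h Hh) (gc h Hh)) => x.
by rewrite /fdiff opprD addrACA.
Qed.

Lemma degree_ltN c f : degree_lt c f -> degree_lt c (fun x => - f x).
Proof.
elim: c f => [f f0 x|c IHc f fc h Hh]; first by rewrite f0 oppr0.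
by apply: degree_lt_ext (IHc _ (fc h Hh)) => x; rewrite /fdiff opprB opprK addrC.
Qed.

Lemma degree_ltB c f g :
  degree_lt c f -> degree_lt c g -> degree_lt c (fun x => f x - g x).
Proof. by move=> fc gc; apply: degree_ltD => //; apply: degree_ltN. Qed.

Lemma degree_lt0 c : degree_lt c (fun=> 0).
Proof.
elim: c => // c IHc h _; apply: degree_lt_ext IHc => x.
by rewrite /fdiff subrr.
Qed.

Lemma degree_ltS c f : degree_lt c f -> degree_lt c.+1 f.
Proof.
elim: c f => [f f0 h _ x|c IHc f fc h Hh]; first by rewrite /fdiff !f0 subrr.
exact/IHc/fc.
Qed.

Lemma degree_lt_leq c c' f : (c <= c')%N -> degree_lt c f -> degree_lt c' f.
Proof.
move=> cc'; rewrite -(subnKC cc') addnC.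
by elim: (c' - c)%N => // d IHd fc; apply/degree_ltS/IHd.
Qed.

Lemma degree_lt_translate c f h :
  H h -> degree_lt c f -> degree_lt c (fun x => f (h * x)%g).
Proof.
move=> Hh fc; apply: degree_lt_ext (degree_ltD fc (degree_ltS fc Hh)) => x.
by rewrite /fdiff addrC subrK.
Qed.

Lemma degree_lt_comp (psi : G -> G) c f :
  {morph psi : x y / (x * y)%g} -> (forall h, H h -> H (psi h)) ->
  degree_lt c f -> degree_lt c (fun x => f (psi x)).
Proof.
move=> psiM psiH; elim: c f => [f f0 x|c IHc f fc h Hh]; first exact: f0.
apply: degree_lt_ext (IHc _ (fc _ (psiH _ Hh))) => x.
by rewrite /fdiff psiM.
Qed.

(** With [I] the augmentation ideal of [H], this congruence holds as soon as
[h - h'] lies in [I^2]; when [k] has characteristic [p], this is so if [h] and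
[h'] agree modulo commutators and [p]-th powers. *)
Definition deg1_eq (h h' : G) : Prop :=
  forall c f, degree_lt c.+2 f -> degree_lt c (fun x => f (h * x)%g - f (h' * x)%g).

Lemma deg1_eq_refl h : deg1_eq h h.
Proof.
by move=> c f _; apply: degree_lt_ext (degree_lt0 c) => x; rewrite subrr.
Qed.

Lemma deg1_eq_sym h h' : deg1_eq h h' -> deg1_eq h' h.
Proof.
move=> hh' c f fc; apply: degree_lt_ext (degree_ltN (hh' c f fc)) => x.
by rewrite opprB.
Qed.

Lemma deg1_eq_trans h2 h1 h3 : deg1_eq h1 h2 -> deg1_eq h2 h3 -> deg1_eq h1 h3.
Proof.
move=> h12 h23 c f fc.
apply: degree_lt_ext (degree_ltD (h12 c f fc) (h23 c f fc)) => x.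
by rewrite addrA subrK.
Qed.

Lemma deg1_eqM h h' l l' : H h' -> H l ->
  deg1_eq h h' -> deg1_eq l l' -> deg1_eq (h * l)%g (h' * l')%g.
Proof.
move=> Hh' Hl hh' ll' c f fc.
have e1 := degree_lt_translate Hl (hh' c f fc).
have e2 := ll' c _ (degree_lt_translate Hh' fc).
by apply: degree_lt_ext (degree_ltD e1 e2) => x; rewrite !mulgA addrA subrK.
Qed.

(** Because [h l - l h = (h - 1) (l - 1) - (l - 1) (h - 1)]. *)
Lemma deg1_eqC h l : H h -> H l -> deg1_eq (h * l)%g (l * h)%g.
Proof.
move=> Hh Hl c f fc.
have e1 : degree_lt c (fdiff l (fdiff h f)) by exact: fc.
have e2 : degree_lt c (fdiff h (fdiff l f)) by exact: fc.
apply: degree_lt_ext (degree_ltB e1 e2) => x.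
by rewrite /fdiff !mulgA; ring.
Qed.

Lemma HX h i : H h -> H (h ^+ i)%g.
Proof. by move=> Hh; elim: i => [|i IHi]; rewrite ?expg0 // expgS; apply: HM. Qed.

(** Because [h^j - 1] agrees with [j (h - 1)] modulo [(h - 1)^2]. *)
Lemma deg1_eqX h a b : H h -> (a%:R = b%:R :> k) -> deg1_eq (h ^+ a)%g (h ^+ b)%g.
Proof.
move=> Hh ab c f fc.
have expand j : degree_lt c (fun x => f (h ^+ j * x)%g - (f x + j%:R * fdiff h f x)).
  elim: j => [|j IHj].
    by apply: degree_lt_ext (degree_lt0 c) => x; rewrite expg0 mul1g mul0r addr0 subrr.
  have step : degree_lt c (fun x => fdiff h f (h ^+ j * x)%g - fdiff h f x).
    by have := fc _ Hh; apply; apply: HX.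
  apply: degree_lt_ext (degree_ltD IHj step) => x.
  by rewrite /fdiff mulgA -expgS -natr1; ring.
apply: degree_lt_ext (degree_ltB (expand a) (expand b)) => x.
by rewrite ab; ring.
Qed.

Section FinitelyGenerated.
Variables (J : finType) (gam : J -> G) (p : nat).
Hypothesis gamH : forall j, H (gam j).
Hypothesis gam_gen : forall h, H h -> exists w : seq J, h = (\prod_(j <- w) gam j)%g.
Hypothesis p_gt0 : (0 < p)%N.
Hypothesis p_char : p%:R = 0 :> k.

Let power_prod (e : J -> nat) (s : seq J) : G := (\prod_(j <- s) gam j ^+ e j)%g.

Lemma H_prod (I : Type) (s : seq I) (F : I -> G) :
  (forall i, H (F i)) -> H (\prod_(i <- s) F i)%g.
Proof.
by move=> HF; elim: s => [|i s IHs]; rewrite ?big_nil // big_cons; apply: HM.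
Qed.

Let power_prodH e s : H (power_prod e s).
Proof. by apply: H_prod => j; apply: HX. Qed.

Lemma deg1_eq_push l s e : l \in s -> uniq s ->
  deg1_eq (gam l * power_prod e s)%g (power_prod (fun j => e j + (j == l))%N s).
Proof.
rewrite /power_prod; elim: s => //= j s IHs; rewrite inE => js /andP[jNs s_uniq].
rewrite !big_cons; have [jl|jl] := eqVneq j l.
  rewrite jl addn1 mulgA -expgS; apply: deg1_eqM; rewrite ?jl;
      [exact: HX | exact: power_prodH | exact: deg1_eq_refl | ].
  rewrite (eq_big_seq (fun j => gam j ^+ (e j + (j == l)))%g).
    exact: deg1_eq_refl.
  move=> i /= si; case: eqP si => [->|]; last by rewrite addn0.
  by rewrite -jl (negPf jNs).
rewrite addn0; move: js; rewrite eq_sym (negPf jl) /= => ls.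
rewrite mulgA; apply: (@deg1_eq_trans (gam j ^+ e j * gam l * power_prod e s)%g).
  apply: deg1_eqM; [|exact: power_prodH| |exact: deg1_eq_refl].
    by apply: HM => //; apply: HX.
  by apply: deg1_eqC => //; apply: HX.
rewrite -mulgA; apply: deg1_eqM; last exact: IHs.
- exact: HX.
- by apply: HM => //; apply: power_prodH.
- exact: deg1_eq_refl.
Qed.

Lemma deg1_eq_power_prod (w : seq J) :
  deg1_eq (\prod_(j <- w) gam j)%g (power_prod (fun j => count_mem j w) (enum J)).
Proof.
elim: w => [|l w IHw].
  rewrite big_nil /power_prod big1 => [|j _]; last exact: expg0.
  exact: deg1_eq_refl.
rewrite big_cons.
apply: (@deg1_eq_trans (gam l * power_prod (fun j => count_mem j w) (enum J))%g).
  by apply: deg1_eqM => //; [exact: H_prod | exact: deg1_eq_refl].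
apply: deg1_eq_trans (deg1_eq_push _ _ _) _; rewrite ?mem_enum ?enum_uniq //.
rewrite /power_prod (eq_bigr (fun j => gam j ^+ count_mem j (l :: w))%g).
  exact: deg1_eq_refl.
by move=> j _; rewrite /= addnC eq_sym.
Qed.

(** The quotient by the congruence is commutative of exponent [p], so a product of
generators only depends on their multiplicities modulo [p]. *)
Lemma deg1_eq_count (w w' : seq J) :
  (forall j, count_mem j w = count_mem j w' %[mod p]) ->
  deg1_eq (\prod_(j <- w) gam j)%g (\prod_(j <- w') gam j)%g.
Proof.
move=> ww'; apply: deg1_eq_trans (deg1_eq_power_prod w) _.
apply: deg1_eq_trans _ (deg1_eq_sym (deg1_eq_power_prod w')).
rewrite /power_prod; elim: (enum J) => [|j s IHs].
  by rewrite !big_nil; apply: deg1_eq_refl.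
rewrite !big_cons; apply: deg1_eqM => //; [exact: HX|exact: power_prodH|].
apply: deg1_eqX => //.
have modk a : a%:R = (a %% p)%:R :> k.
  by rewrite {1}(divn_eq a p) natrD natrM p_char mulr0 add0r.
by rewrite modk (modk (count_mem j w')) ww'.
Qed.

(** An iterate is determined, up to the congruence, by a square table of exponents
modulo [p] indexed by the generators; there are finitely many tables. *)
Lemma deg1_eq_iter (phi : G -> G) (B : nat) :
  {morph phi : x y / (x * y)%g} -> (forall h, H h -> H (phi h)) ->
  ((p ^ #|J|) ^ #|J| <= B)%N ->
  forall h, H h -> deg1_eq (iter (B`! + B`!) phi h) (iter B`! phi h).
Proof.
move=> phiM phiH JB.
have iterM i : {morph iter i phi : x y / (x * y)%g}.
  by move=> x y; elim: i => //= i ->; apply: phiM.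
have iterH i h : H h -> H (iter i phi h) by move=> Hh; elim: i => //= i; apply: phiH.
have /choice[W WP] (ij : nat * J) : exists w : seq J,
    iter ij.1 phi (gam ij.2) = (\prod_(l <- w) gam l)%g.
  exact/gam_gen/iterH.
(* The image of the generator [j] under the [i]-th iterate is recorded, up to
   the congruence, by its exponents modulo [p]. *)
pose code i := [ffun j => [ffun l =>
  Ordinal (ltn_pmod (count_mem l (W (i, j))) p_gt0)]].
pose R i j := forall h, H h -> deg1_eq (iter j phi h) (iter i phi h).
have := @shift_pigeonhole _ code R B _ _ _ _ 0%N; rewrite addn0; apply.
- by move=> i j l ij jl h Hh; apply: deg1_eq_trans (jl h Hh) (ij h Hh).
- by move=> i j ij h Hh; rewrite !iterSr; apply/ij/phiH.
- move=> i j ij h /gam_gen[w ->].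
  elim: w => [|l w IHw].
    by rewrite big_nil !(morph_mulg1 (iterM _)); apply: deg1_eq_refl.
  rewrite big_cons !iterM; apply: deg1_eqM => //; try exact: iterH.
    exact/iterH/H_prod.
  rewrite (WP (j, l)) (WP (i, l)); apply: deg1_eq_count => q.
  by have /ffunP/(_ l) := ij; rewrite !ffunE => /ffunP/(_ q); rewrite !ffunE => -[->].
- by rewrite !card_ffun card_ord.
Qed.

End FinitelyGenerated.

Section Idempotent.
Variable psi : G -> G.
Hypothesis psiM : {morph psi : x y / (x * y)%g}.
Hypothesis psiH : forall h, H h -> H (psi h).
Hypothesis psi_coset : forall x, exists2 h, H h & psi (psi x) = (h * psi x)%g.
Hypothesis psi_deg1 : forall h, H h -> deg1_eq (psi (psi h)) (psi h).

Definition idem_defect f : G -> k := fun x => f (psi (psi x)) - f (psi x).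

(** On group elements, [psi (psi h) - psi h] lies one step deeper in the
augmentation filtration by [psi_deg1]; the product rule propagates this to all
degrees, with [psi_coset] as the case of degree zero. *)
Lemma degree_lt_defect c f : degree_lt c.+1 f -> degree_lt c (idem_defect f).
Proof.
elim: c f => [f f1 x|c IHc f fc h Hh].
  by have [h Hh e] := psi_coset x; rewrite /idem_defect e; apply: f1.
have e1 := degree_lt_comp psiM psiH (degree_lt_comp psiM psiH (psi_deg1 Hh fc)).
have e2 := IHc _ (fc _ (psiH Hh)).
apply: degree_lt_ext (degree_ltD e1 e2) => x.
by rewrite /fdiff /idem_defect !psiM; ring.
Qed.

(** Polynomials act on functions with the variable acting as composition with
[psi], so that Frobenius can be used in the ring [{poly k}]. *)
Definition poly_act (P : {poly k}) f : G -> k :=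
  fun x => \sum_(i < size P) P`_i * f (iter i psi x).

Lemma poly_act_wide n (P : {poly k}) f x : (size P <= n)%N ->
  poly_act P f x = \sum_(i < n) P`_i * f (iter i psi x).
Proof.
move=> Pn; rewrite /poly_act (big_ord_widen n (fun i => P`_i * f (iter i psi x))) //.
rewrite big_mkcond; apply: eq_bigr => i _; case: ltnP => // Pi.
by rewrite nth_default ?mul0r.
Qed.

Lemma poly_actXM P f x : poly_act ('X * P) f x = poly_act P f (psi x).
Proof.
rewrite (@poly_act_wide (size P).+1); last first.
  by apply: leq_trans (size_polyMleq _ _) _; rewrite size_polyX.
rewrite big_ord_recl coefXM mul0r add0r; apply: eq_bigr => i _.
by rewrite coefXM /= -iterS iterSr.
Qed.

Lemma poly_actB P Q f x : poly_act (P - Q) f x = poly_act P f x - poly_act Q f x.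
Proof.
pose n := maxn (size P) (size Q).
rewrite !(@poly_act_wide n) ?leq_maxl ?leq_maxr //; last first.
  by apply: leq_trans (size_polyD _ _) _; rewrite size_polyN.
by rewrite -sumrB; apply: eq_bigr => i _; rewrite coefB mulrBl.
Qed.

Lemma poly_actXn n f x : poly_act 'X^n f x = f (iter n psi x).
Proof.
rewrite /poly_act size_polyXn big_ord_recr /= coefXn eqxx mul1r big1 ?add0r //.
by move=> i _; rewrite coefXn (ltn_eqF (ltn_ord i)) mul0r.
Qed.

Lemma poly_act_defect c f x Q :
  degree_lt c f -> poly_act (('X^2 - 'X) ^+ c * Q) f x = 0.
Proof.
elim: c f Q => [f Q f0|c IHc f Q fc].
  by rewrite /poly_act big1 // => i _; rewrite f0 mulr0.
rewrite -[RHS](IHc _ Q (degree_lt_defect fc)) exprS -mulrA mulrBl expr2 -mulrA.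
rewrite poly_actB !poly_actXM /poly_act -sumrB; apply: eq_bigr => i _.
by rewrite -mulrBr /idem_defect -!iterS -!iterSr.
Qed.

(** In characteristic [p] the operator [(X^2 - X) ^ (p^c)] is
[X^(2 p^c) - X^(p^c)], and it kills [f] because [c <= p^c]. *)
Lemma degree_lt_frobenius p c f x : p \in [pchar k] ->
  degree_lt c f -> f (iter (2 * p ^ c) psi x) = f (iter (p ^ c) psi x).
Proof.
move=> pk fc; apply/eqP; rewrite -subr_eq0 -!poly_actXn -poly_actB exprM.
have pP : p \in [pchar {poly k}] by rewrite pchar_poly.
have cpc : (c <= p ^ c)%N.
  by rewrite ltnW // ltn_expl // prime_gt1 // (pcharf_prime pk).
have := poly_act_defect x 1 (degree_lt_leq cpc fc).
have pqP : [pchar {poly k}].-nat (p ^ c)%N.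
  rewrite pnatX (eq_pnat _ (pchar_poly k)) (eq_pnat _ (pcharf_eq pk)).
  by rewrite pnat_id ?(pcharf_prime pk).
have -> : 'X^2 ^+ (p ^ c) = ('X^2 - 'X) ^+ (p ^ c) + 'X^(p ^ c) :> {poly k}.
  by rewrite -exprDn_pchar // subrK.
by rewrite mulr1 addrK => ->.
Qed.

(** On the finite orbit of [x] finitely many pairs must be separated, so one degree
[c] serves; there [psi^(2 p^c)] and [psi^(p^c)] agree on a preimage of [x] under
[psi^(p^c)]. *)
Lemma period_power p r x : p \in [pchar k] ->
  (forall y z : G, y <> z -> exists c f, degree_lt c f /\ f y <> f z) ->
  (0 < r)%N -> iter r psi x = x -> exists a, iter (p ^ a) psi x = x.
Proof.
move=> pk sep r0 xr.
have iter_mul m : iter (m * r) psi x = x.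
  by elim: m => // m IHm; rewrite mulSn iterD IHm xr.
have iter_mod j : iter j psi x = iter (j %% r) psi x.
  by rewrite {1}(divn_eq j r) addnC iterD iter_mul.
have [c sepc] : exists c, forall i : 'I_r, iter i psi x <> x ->
    exists2 f, degree_lt c f & f (iter i psi x) <> f x.
  have /choice[c cP] (i : 'I_r) : exists c, iter i psi x <> x ->
      exists2 f, degree_lt c f & f (iter i psi x) <> f x.
    have [->|/sep[c [f [fc fx]]]] := pselect (iter i psi x = x).
      by exists 0%N.
    by exists c => _; exists f.
  exists (\max_i c i) => i /cP[f fc fx]; exists f => //.
  by apply: degree_lt_leq fc; apply: leq_bigmax.
exists c; apply: contrapT; rewrite iter_mod => neq.
have [f fc] := sepc (Ordinal (ltn_pmod (p ^ c) r0)) neq; apply.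
rewrite /= -iter_mod.
have := degree_lt_frobenius (iter (p ^ c * r.-1) psi x) pk fc.
rewrite -!iterD mul2n -addnn -addnA -mulnS prednK // mulnC iterD.
by rewrite (mulnC r) iter_mul.
Qed.

End Idempotent.
End Ring.
End PolynomialDegree.

Section Separation.
Local Open Scope ring_scope.
Variables (G : groupType) (n : nat) (alpha : 'I_n -> G).
Hypothesis alpha_free : free_family alpha.

Variables (H : G -> Prop).
Hypothesis H1 : H 1%g.
Hypothesis HM : forall x y, H x -> H y -> H (x * y)%g.
Hypothesis HV : forall x, H x -> H (x^-1)%g.
Hypothesis H_spanned : forall x, H x -> spanned alpha x.

(** A finite field may be too small to hold [2 n] different slopes, hence the
auxiliary variable. *)
Lemma slope_poly_inj (p : nat) :
  injective (slope (fun i : 'I_n => 'X^(i.+1) : {poly 'F_p})).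
Proof.
case=> i b [j b'] e.
have ebb : b = b'.
  have /(congr1 (horner^~ 0)) := e; rewrite /slope /=.
  rewrite !hornerD !hornerXn !expr0n !add0r.
  by case: b b' {e} => [] [] //= /eqP; rewrite !hornerE ?oner_eq0 // eq_sym oner_eq0.
move: e; rewrite -ebb /slope /= => /addIr.
move=> /(congr1 (fun P : {poly 'F_p} => size P)).
by rewrite !size_polyXn => -[ij]; congr pair; apply/val_inj.
Qed.

(** Points in different cosets of [H] are separated by an indicator function, of
degree zero. Within the coset of [y], the coefficient of [t^j] in an entry of
[rho (x / y)] has degree at most [j]: a difference along [H] multiplies [rho] by
some [rho h - 1], which is divisible by [t]. *)
Lemma degree_lt_separation (p : nat) (y z : G) : y <> z ->
  exists c (f : G -> {poly 'F_p}), degree_lt H c f /\ f y <> f z.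
Proof.
move=> yz; have [Hzy|nHzy] := pselect (H (z / y)%g); last first.
  exists 1%N, (fun x => if `[< H (x / y)%g >] then 1 else 0); split; last first.
    rewrite mulgV (asboolT H1) asboolF // => /eqP; by rewrite oner_eq0.
  move=> h Hh x; rewrite /fdiff.
  have -> : `[< H (h * x / y)%g >] = `[< H (x / y)%g >].
    apply: asbool_equiv_eq; rewrite -mulgA; split=> [Hhx|]; last exact: HM.
    by rewrite -(mulKg h (x / y)%g); apply: HM => //; apply: HV.
  by rewrite subrr.
pose c := fun i : 'I_n => 'X^(i.+1) : {poly 'F_p}.
pose rho := free_rep alpha (letter_mx c).
have rhoM g h : H g -> H h -> rho (g * h)%g = rho g * rho h.
  by move=> /H_spanned Fg /H_spanned Fh; apply: free_repM => //; apply: letter_mxV.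
have rho1 : rho 1%g = 1 by apply: free_rep1 => //; apply: letter_mxV.
have rho_mod h : H h -> exists M, rho h = 1 + 'X *: M.
  move=> _; rewrite /rho /free_rep; elim: word_of => [|l w [M MP]].
    by exists 0; rewrite big_nil scaler0 addr0.
  rewrite big_cons MP; have [M' ->] := letter_mx_mod c l.
  exists (M' + (1 + 'X *: M') * M).
  by rewrite mulrDr mulr1 -addrA scalerDr -scalerAr.
pose f (B : 'M[{poly {poly 'F_p}}]_2) a b j x : {poly 'F_p} :=
  if `[< H (x / y)%g >] then ((B * rho (x / y)%g) a b)`_j else 0.
have fP j a b m i (B : 'M[{poly {poly 'F_p}}]_2) : (j < i + m)%N ->
    degree_lt H m (f ('X^i *: B) a b j).
  elim: m i B => [|m IHm] i B ji.
    move=> x; rewrite /f; case: ifP => // _.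
    by rewrite -scalerAl mxE coefXnM -[i]addn0 ji.
  move=> h Hh; have [M hM] := rho_mod h Hh.
  have := IHm i.+1 (B * M); rewrite addSnnS => /(_ ji).
  apply: degree_lt_ext => x; rewrite /fdiff /f -mulgA.
  case: asboolP => Hx; last first.
    case: asboolP => Hhx; last by rewrite subrr.
    by case: Hx; rewrite -(mulKg h (x / y)%g); apply: HM => //; apply: HV.
  rewrite asboolT; last exact: HM.
  rewrite (rhoM h (x / y)%g) // hM -coefB; congr (_`_j).
  set R := rho _; rewrite mulrDl mul1r mulrDr.
  rewrite [in RHS]mxE addrAC subrr add0r.
  by rewrite exprSr -scalerA -!scalerAl -!scalerAr scalerAl !mulrA -?scalerAl -?scalerAr.
have rho_neq : rho (z / y)%g <> 1.
  apply: letter_rep_faithful (slope_poly_inj (p := p)) (H_spanned Hzy) _ => //.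
  by move=> /divg1_eq zy; apply: yz.
have [a [b [j abj]]] : exists a b j,
    (rho (z / y)%g a b)`_j <> ((1 : 'M[{poly {poly 'F_p}}]_2) a b)`_j.
  apply: contrapT => nex; apply: rho_neq; apply/matrixP => a b; apply/polyP => j.
  by apply: contrapT => abj; apply: nex; exists a, b, j.
exists j.+1, (f 1 a b j); split.
  by have := fP j a b j.+1 0%N 1; rewrite expr0 scale1r; apply; rewrite add0n.
by rewrite /f mulgV !asboolT // !mul1r rho1 => /esym.
Qed.

End Separation.

(** * Algebraic independence and chains of prime ideals *)

Section PolynomialFunctions.
Local Open Scope ring_scope.
Variables (K : fieldType) (L : Type) (N : nat) (x : 'I_N -> L -> K).

Definition monomial_fun (e : 'I_N -> nat) (r : L) : K := \prod_j x j r ^+ e j.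

(** Bounding the exponent of each coordinate, rather than the total degree, makes
the monomials a type of cardinal [D ^ N]. *)
Definition poly_lt (D : nat) (f : L -> K) : Prop :=
  exists c : {ffun 'I_N -> 'I_D} -> K,
    forall r, f r = \sum_m c m * monomial_fun (fun j => m j) r.

Definition polynomial_fun (f : L -> K) : Prop := exists D, poly_lt D f.

Lemma poly_lt_monomial D (e : 'I_N -> nat) (f : L -> K) :
  (forall j, (e j < D)%N) -> f =1 monomial_fun e -> poly_lt D f.
Proof.
move=> eD fe; pose m0 : {ffun 'I_N -> 'I_D} := [ffun j => Ordinal (eD j)].
exists (fun m => (m == m0)%:R) => r.
rewrite (bigD1 m0) //= eqxx mul1r big1 ?addr0; last first.
  by move=> m /negPf ->; rewrite mul0r.
by rewrite fe /monomial_fun; apply: eq_bigr => j _; rewrite ffunE.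
Qed.

Lemma poly_ltZ D a f : poly_lt D f -> poly_lt D (fun r => a * f r).
Proof.
move=> [c fc]; exists (fun m => a * c m) => r.
by rewrite fc mulr_sumr; apply: eq_bigr => m _; rewrite mulrA.
Qed.

Lemma poly_ltD D f g : poly_lt D f -> poly_lt D g -> poly_lt D (fun r => f r + g r).
Proof.
move=> [c fc] [d gd]; exists (fun m => c m + d m) => r.
by rewrite fc gd -big_split; apply: eq_bigr => m _; rewrite mulrDl.
Qed.

Lemma poly_lt0 D : poly_lt D (fun _ => 0).
Proof. by exists (fun _ => 0) => r; rewrite big1 // => m _; rewrite mul0r. Qed.

Lemma poly_lt_ext D f g : f =1 g -> poly_lt D f -> poly_lt D g.
Proof. by move=> fg; rewrite (funext fg). Qed.

Lemma poly_lt_sum D (I : Type) (s : seq I) (P : pred I) (f : I -> L -> K) :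
  (forall i, P i -> poly_lt D (f i)) -> poly_lt D (fun r => \sum_(i <- s | P i) f i r).
Proof.
move=> fP; elim: s => [|i s IHs].
  by apply: poly_lt_ext (poly_lt0 D) => r; rewrite big_nil.
case Pi: (P i); last by apply: poly_lt_ext IHs => r; rewrite big_cons Pi.
by apply: poly_lt_ext (poly_ltD (fP i Pi) IHs) => r; rewrite big_cons Pi.
Qed.

Lemma poly_lt_leq D D' f : (D <= D')%N -> poly_lt D f -> poly_lt D' f.
Proof.
move=> DD' [c fc]; apply: poly_lt_ext (fun r => esym (fc r)) _.
apply: poly_lt_sum => m _; apply/poly_ltZ.
apply: (poly_lt_monomial (e := fun j => m j)) => // j.
exact: leq_trans (ltn_ord _) DD'.
Qed.

Lemma poly_ltM D D' f g :
  poly_lt D f -> poly_lt D' g -> poly_lt (D + D') (fun r => f r * g r).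
Proof.
move=> [c fc] [d gd].
apply: (@poly_lt_ext _ (fun r => \sum_m \sum_m' (c m * d m') *
   (monomial_fun (fun j => m j) r * monomial_fun (fun j => m' j) r))).
  move=> r; rewrite fc gd mulr_suml; apply: eq_bigr => m _.
  by rewrite mulr_sumr; apply: eq_bigr => m' _; rewrite mulrACA.
apply: poly_lt_sum => m _; apply: poly_lt_sum => m' _; apply: poly_ltZ.
apply: (poly_lt_monomial (e := fun j => m j + m' j)%N) => [j|r].
  by have := ltn_ord (m j); have := ltn_ord (m' j); lia.
by rewrite /monomial_fun -big_split; apply: eq_bigr => j _; rewrite exprD.
Qed.

Lemma poly_lt_cst a : poly_lt 1 (fun _ => a).
Proof.
apply: (@poly_lt_ext _ (fun r => a * 1)) => [r|]; first by rewrite mulr1.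
apply: poly_ltZ; apply: (poly_lt_monomial (e := fun=> 0%N)) => // r.
by rewrite /monomial_fun big1.
Qed.

Lemma poly_ltX D f k : poly_lt D f -> poly_lt (D * k).+1 (fun r => f r ^+ k).
Proof.
move=> fD; elim: k => [|k IHk].
  by rewrite muln0; apply: poly_lt_ext (poly_lt_cst 1) => r; rewrite expr0.
rewrite mulnS -addnS.
by apply: poly_lt_ext (poly_ltM fD IHk) => r; rewrite exprS.
Qed.

Lemma poly_lt_prod D (I : Type) (s : seq I) (f : I -> L -> K) :
  (forall i, poly_lt D (f i)) ->
  poly_lt (D * size s).+1 (fun r => \prod_(i <- s) f i r).
Proof.
move=> fD; elim: s => [|i s IHs] /=.
  by rewrite muln0; apply: poly_lt_ext (poly_lt_cst 1) => r; rewrite big_nil.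
rewrite mulnS -addnS.
by apply: poly_lt_ext (poly_ltM (fD i) IHs) => r; rewrite big_cons.
Qed.

Lemma poly_funM f g : polynomial_fun f -> polynomial_fun g ->
  polynomial_fun (fun r => f r * g r).
Proof. by move=> [D fD] [D' gD']; exists (D + D')%N; apply: poly_ltM. Qed.

Lemma poly_funD f g : polynomial_fun f -> polynomial_fun g ->
  polynomial_fun (fun r => f r + g r).
Proof.
move=> [D fD] [D' gD']; exists (D + D')%N; apply: poly_ltD.
  exact: poly_lt_leq (leq_addr _ _) fD.
exact: poly_lt_leq (leq_addl _ _) gD'.
Qed.

Lemma poly_fun_cst a : polynomial_fun (fun _ => a).
Proof. by exists 1%N; apply: poly_lt_cst. Qed.

Lemma poly_fun_ext f g : f =1 g -> polynomial_fun f -> polynomial_fun g.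
Proof. by move=> fg; rewrite (funext fg). Qed.

Lemma poly_funX f k : polynomial_fun f -> polynomial_fun (fun r => f r ^+ k).
Proof. by move=> [D fD]; exists (D * k).+1; apply: poly_ltX. Qed.

Lemma poly_fun_sum (I : Type) (s : seq I) (P : pred I) (f : I -> L -> K) :
  (forall i, P i -> polynomial_fun (f i)) ->
  polynomial_fun (fun r => \sum_(i <- s | P i) f i r).
Proof.
move=> fP; elim: s => [|i s IHs].
  by apply: poly_fun_ext (poly_fun_cst 0) => r; rewrite big_nil.
case Pi: (P i); last by apply: poly_fun_ext IHs => r; rewrite big_cons Pi.
by apply: poly_fun_ext (poly_funD (fP i Pi) IHs) => r; rewrite big_cons Pi.
Qed.

Lemma poly_fun_prod (I : Type) (s : seq I) (P : pred I) (f : I -> L -> K) :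
  (forall i, P i -> polynomial_fun (f i)) ->
  polynomial_fun (fun r => \prod_(i <- s | P i) f i r).
Proof.
move=> fP; elim: s => [|i s IHs].
  by apply: poly_fun_ext (poly_fun_cst 1) => r; rewrite big_nil.
case Pi: (P i); last by apply: poly_fun_ext IHs => r; rewrite big_cons Pi.
by apply: poly_fun_ext (poly_funM (fP i Pi) IHs) => r; rewrite big_cons Pi.
Qed.

Lemma poly_fun_coord j : polynomial_fun (x j).
Proof.
exists 2; apply: (poly_lt_monomial (e := fun i => (i == j) : nat)) => [i|r].
  by case: (i == j).
rewrite /monomial_fun (bigD1 j) //= eqxx expr1 big1 ?mulr1 // => i /negPf ->.
by rewrite expr0.
Qed.

Lemma poly_fun_comp (Phi : L -> L) f :
  (forall j, polynomial_fun (fun r => x j (Phi r))) ->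
  polynomial_fun f -> polynomial_fun (fun r => f (Phi r)).
Proof.
move=> PhiP [D [c fc]].
apply: poly_fun_ext (fun r => esym (fc (Phi r))) _.
apply: poly_fun_sum => m _; apply: poly_funM; first exact: poly_fun_cst.
by apply: poly_fun_prod => j _; apply: poly_funX.
Qed.

Lemma poly_fun_uniform (I : finType) (f : I -> L -> K) :
  (forall i, polynomial_fun (f i)) -> exists D, forall i, poly_lt D (f i).
Proof.
move=> /choice[D fD]; exists (\max_i D i) => i.
by apply: poly_lt_leq (fD i); apply: leq_bigmax.
Qed.

(** There are [d ^ N.+1] monomials in the [f i] with exponents less than [d], and
they lie in a span of [(C d) ^ N] monomials in the coordinates for a constant
[C]; for large [d] they are linearly dependent. *)
Lemma algebraic_dependence (f : 'I_N.+1 -> L -> K) :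
  (forall i, polynomial_fun (f i)) ->
  exists d (c : {ffun 'I_N.+1 -> 'I_d} -> K),
    (exists e, c e != 0) /\
    forall r, \sum_e c e * \prod_i f i r ^+ e i = 0.
Proof.
move=> /poly_fun_uniform[E fE]; pose C := ((E + 2) * N.+1)%N.
(* Monomials in the [f i] with exponents less than [d] have exponents less than
   [D <= C * d] in the coordinates, and [d] is chosen so that
   [(C * d) ^ N < d ^ N.+1]. *)
pose d := (C ^ N).+1; pose D := ((E * d).+1 * N.+1).+1.
have fP (e : {ffun 'I_N.+1 -> 'I_d}) : poly_lt D (fun r => \prod_i f i r ^+ e i).
  have := @poly_lt_prod (E * d).+1 _ (index_enum 'I_N.+1) (fun i r => f i r ^+ e i).
  rewrite /index_enum -enumT size_enum_ord; apply=> i.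
  apply: poly_lt_leq (poly_ltX (e i) (fE i)).
  by rewrite ltnS leq_mul2l ltnW ?orbT.
have [a aP] := choice fP.
pose A := \matrix_(i < #|{ffun 'I_N.+1 -> 'I_d}|, j < #|{ffun 'I_N -> 'I_D}|)
  a (enum_val i) (enum_val j).
have card_lt : (#|{ffun 'I_N -> 'I_D}| < #|{ffun 'I_N.+1 -> 'I_d}|)%N.
  rewrite !card_ffun !card_ord.
  have DC : (D <= C * d)%N by rewrite /D /C; have : (0 < d)%N by []; nia.
  have DCX k : (D ^ k <= (C * d) ^ k)%N by case: k => // k; rewrite leq_exp2r.
  apply: leq_ltn_trans (DCX N) _.
  by rewrite expnMn expnS ltn_mul2r ltnSn expn_gt0.
have : kermx A != 0.
  rewrite -mxrank_eq0 mxrank_ker -lt0n subn_gt0.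
  exact: leq_ltn_trans (rank_leq_col A) card_lt.
case/rowV0Pn => v /sub_kermxP vA v0.
exists d, (fun e => v 0 (enum_rank e)); split.
  case/rV0Pn: v0 => i vi; exists (enum_val i); by rewrite enum_valK.
move=> r; under eq_bigr => e _ do rewrite aP mulr_sumr.
rewrite exchange_big big1 //= => m _.
under eq_bigr => e _ do rewrite mulrA.
rewrite -mulr_suml (_ : \sum__ _ = 0) ?mul0r //.
rewrite (reindex _ (onW_bij _ (enum_val_bij {ffun 'I_N.+1 -> 'I_d}))) /=.
have /rowP/(_ (enum_rank m)) := vA; rewrite !mxE => vAm.
rewrite -[RHS]vAm; by apply: eq_bigr => i _; rewrite mxE enum_rankK enum_valK.
Qed.

Section Dynamics.
Variable Phi : L -> L.
Hypothesis Phi_poly : forall j, polynomial_fun (fun r => x j (Phi r)).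
Hypothesis irreducible : forall f g : L -> K,
  polynomial_fun f -> polynomial_fun g -> (forall r, f r * g r = 0) ->
  (forall r, f r = 0) \/ (forall r, g r = 0).
Hypothesis inhabited_L : inhabited L.

Let vanish i (f : L -> K) := forall r, f (iter i Phi r) = 0.

Lemma poly_fun_iter i f : polynomial_fun f ->
  polynomial_fun (fun r => f (iter i Phi r)).
Proof.
elim: i f => // i IHi f fP; have := IHi _ (poly_fun_comp Phi_poly fP).
exact: poly_fun_ext.
Qed.

(** Pulling back along [Phi] preserves polynomial functions, so the closure of
each image is irreducible like the whole space. *)
Lemma vanish_prime i f g : polynomial_fun f -> polynomial_fun g ->
  vanish i (fun r => f r * g r) -> vanish i f \/ vanish i g.
Proof.
by move=> fP gP fg; apply: irreducible fg; apply: poly_fun_iter.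
Qed.

Lemma vanishX i f k : polynomial_fun f -> vanish i (fun r => f r ^+ k) -> vanish i f.
Proof.
move=> fP; elim: k => [f1 r|k IHk fk].
  by have /eqP := f1 r; rewrite expr0 oner_eq0.
have [r|//|/IHk//] := @vanish_prime i f (fun r => f r ^+ k) fP (poly_funX k fP).
by have := fk r; rewrite exprS.
Qed.

(** Each [f i] is nonzero on the [i]-th image but vanishes on the next one. In a
relation among them, cancel the least power of [f 0] and restrict to the next
image, where [f 0] is zero; this leaves a relation among the others. After [r]
steps a single nonzero coefficient remains. *)
Lemma algebraic_independence (r d : nat) (f : 'I_r -> L -> K)
    (c : {ffun 'I_r -> 'I_d} -> K) :
  (forall i, polynomial_fun (f i)) ->
  (forall i : 'I_r, vanish i.+1 (f i)) -> (forall i : 'I_r, ~ vanish i (f i)) ->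
  (forall y, \sum_e c e * \prod_i f i y ^+ e i = 0) -> forall e, c e = 0.
Proof.
move=> fP f_van f_nvan dep e0; apply/eqP; apply/negPn/negP => ce0.
pose agree i (e e' : {ffun 'I_r -> 'I_d}) :=
  [forall j : 'I_r, (j < i)%N ==> (e' j == e j)].
have agreeP i (e e' : {ffun 'I_r -> 'I_d}) :
    reflect (forall j : 'I_r, (j < i)%N -> e' j = e j) (agree i e e').
  apply: (iffP forallP) => h j.
    by move=> ji; apply/eqP; have := h j; rewrite ji.
  by apply/implyP=> ji; apply/eqP/h.
pose tail i (e : {ffun 'I_r -> 'I_d}) (y : L) :=
  \prod_(j < r | (i <= j)%N) f j y ^+ e j.
(* The terms whose first [i] exponents agree with those of a fixed term of the
   relation still sum to zero on the [i]-th image, once the powers of the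
   first [i] functions are removed. *)
pose P i := exists2 e, c e != 0 &
  vanish i (fun y => \sum_(e' | agree i e e') c e' * tail i e' y).
have P0 : P 0%N.
  exists e0 => // y; rewrite -[RHS](dep (iter 0 Phi y)).
  by apply: eq_bigl => e; apply/agreeP.
have PS i : (i < r)%N -> P i -> P i.+1.
  move=> ir [e1 ce1 e1P]; pose oi := Ordinal ir.
  pose Q e := (c e != 0) && agree i e1 e.
  have Qe1 : Q e1 by rewrite /Q ce1; apply/agreeP.
  (* Divide by the least power of [f oi] that occurs: the other terms contain
     [f oi] as a factor, so they vanish on the next image. *)
  case: (arg_minnP (fun e : {ffun 'I_r -> 'I_d} => e oi : nat) Qe1).
  move=> e /andP[ce /agreeP e1e] emin.
  exists e => //.
  pose g y := \sum_(e' | Q e') c e' * (f oi y ^+ (e' oi - e oi) * tail i.+1 e' y).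
  have gP : polynomial_fun g.
    apply: poly_fun_sum => e' _; apply: poly_funM; first exact: poly_fun_cst.
    apply: poly_funM; first exact: poly_funX.
    by apply: poly_fun_prod => j _; apply: poly_funX.
  have tailE e' y : tail i e' y = f oi y ^+ e' oi * tail i.+1 e' y.
    rewrite /tail (bigD1 oi) //=; congr (_ * _); apply: eq_bigl => j.
    by rewrite ltn_neqAle andbC eq_sym -val_eqE.
  have [|f0|g0] := @vanish_prime i _ _ (poly_funX (e oi) (fP oi)) gP.
  - move=> y; rewrite -[RHS](e1P y) /g mulr_sumr big_mkcond [RHS]big_mkcond.
    apply: eq_bigr => e' _; have := emin e'; rewrite /Q.
    case: (agree i e1 e'); rewrite ?andbF // andbT => em.
    case: ifP => [ce'|/negbFE/eqP->]; last by rewrite mul0r.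
    rewrite tailE mulrCA; congr (_ * _); rewrite mulrA -exprD subnKC //; exact: em.
  - by have /f_nvan := vanishX (fP oi) f0.
  - move=> y; have := g0 (Phi y); rewrite -iterSr => gy.
    rewrite -[RHS]gy /g big_mkcond [RHS]big_mkcond.
    apply: eq_bigr => e' _; rewrite /Q.
    have [ce'|ce'] := eqVneq (c e') 0; first by rewrite ce' !mul0r; case: ifP.
    case: ifP => [/agreeP ee'|ee'].
      have -> : agree i e1 e'.
        by apply/agreeP => j ji; rewrite ee' ?e1e // ltnW.
      by rewrite (ee' oi) // subnn expr0 mul1r.
    case: ifP => //= e1e'; rewrite (f_van oi) expr0n subn_eq0.
    case: leqP => [le|]; last by rewrite mul0r mulr0.
    case/negP: (negbT ee'); apply/agreeP => j.
    rewrite ltnS leq_eqVlt => /orP[/eqP ji|ji].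
      have -> : j = oi by apply/val_inj.
      by apply/val_inj/eqP; rewrite eqn_leq le /=; apply: emin; rewrite /Q ce'.
    by rewrite (agreeP _ _ _ e1e') // e1e.
have Pi i : (i <= r)%N -> P i by elim: i => // i IHi ir; apply/PS/IHi/ltnW.
have [e ce] := Pi r (leqnn r); case: inhabited_L => y /(_ y)/eqP; apply/negP.
rewrite (bigD1 e) ?big1 /=; last 2 first.
- move=> e' /andP[/agreeP ee' /eqP]; case; apply/ffunP => j; exact: ee'.
- exact/agreeP.
rewrite addr0 mulf_neq0 // /tail big_pred0 ?oner_neq0 // => j.
by rewrite leqNgt ltn_ord.
Qed.

(** Equality of two consecutive ideals persists, since each ideal is obtained from
the previous one by pulling back along [Phi]. So a failure at [N] would make the
first [N.+1] inclusions strict, and provide [N.+1] algebraically independent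
functions of [N] coordinates. *)
Lemma vanish_stable i f : polynomial_fun f -> vanish i f -> vanish N f.
Proof.
move=> fP fi.
have vanishS k g : vanish k g -> vanish k.+1 g.
  by move=> gk y; rewrite iterSr gk.
have vanish_leq k l g : (k <= l)%N -> vanish k g -> vanish l g.
  by move=> kl gk y; rewrite -(subnKC kl) iterD gk.
have [[j jN stab]|nstab] := pselect (exists2 j, (j <= N)%N &
    forall g, polynomial_fun g -> vanish j.+1 g -> vanish j g).
  apply: (vanish_leq _ _ _ jN).
  have [ij|ji] := leqP i j; first exact: vanish_leq ij fi.
  have : vanish (i - j + j) f by rewrite subnK // ltnW.
  elim: (i - j)%N f fP {fi ji} => // k IHk f fP fk; apply: IHk => //.
  have : vanish j (fun y => f (iter k Phi y)).
    apply: stab; first exact: poly_fun_iter.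
    by move=> y; have := fk y; rewrite addSnnS iterD.
  by move=> h y; have := h y; rewrite iterD.
have gP (j : 'I_N.+1) : exists g : L -> K,
    [/\ polynomial_fun g, vanish j.+1 g & ~ vanish j g].
  apply: contrapT => h; apply: nstab; exists (j : nat); first by rewrite -ltnS.
  by move=> g gP gj; apply: contrapT => ngj; apply: h; exists g.
have [g {}gP] := choice gP.
have gpoly j : polynomial_fun (g j) by case: (gP j).
have [d [c [[e ce] dep]]] := algebraic_dependence gpoly.
by case/eqP: ce; apply: (algebraic_independence gpoly) dep e => j; case: (gP j).
Qed.

End Dynamics.
End PolynomialFunctions.

(** * The variety of representations in SL2 *)

Section PathConnected.
Local Open Scope ring_scope.

Definition eval_mx (R : comNzRingType) m (t : R) : 'M[{poly R}]_m -> 'M[R]_m :=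
  map_mx (horner_eval t).

Definition elementary_word (R : nzRingType) (v : 'I_4 -> R) : 'M[R]_2 :=
  mx2 1 (v 0) 0 1 * mx2 1 0 (v 1) 1 * mx2 1 (v 2%:R) 0 1 * mx2 1 0 (v 3%:R) 1.

Lemma SL2_elementary (K : fieldType) (A : 'M[K]_2) :
  \det A = 1 -> exists v, A = elementary_word v.
Proof.
suff main a b c d : a * d - b * c = 1 ->
    exists p q r s : K,
      mx2 a b c d = mx2 1 p 0 1 * mx2 1 0 q 1 * mx2 1 r 0 1 * mx2 1 0 s 1.
  rewrite (mx2E A) det_mx2E => /main[p [q [r [s ->]]]].
  exists (fun i : 'I_4 => nth 0 [:: p; q; r; s] i).
  by rewrite /elementary_word /=.
(* If [c] is not zero, the three factors [p], [q = c], [r] suffice; otherwise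
   a last factor with [s = -1] reduces to that case. *)
have [c0|c0] := eqVneq c 0; last first.
  move=> e; exists ((a - 1) / c), c, ((d - 1) / c), 0.
  have bE : b = (a * d - 1) / c by rewrite -e; field.
  by rewrite bE !mx2M; congr mx2; field.
rewrite c0 mulr0 subr0 => e.
have d0 : d != 0 by apply: contra_eq_neq e => ->; rewrite mulr0 eq_sym oner_neq0.
have aE : a = d^-1 by apply: (mulIf d0); rewrite e mulVf.
exists ((a + b - 1) / d), d, ((d - 1) / d), (-1).
by rewrite aE !mx2M; congr mx2; field.
Qed.

(** The parameters of the elementary factors are interpolated linearly. *)
Lemma SL2_path (K : fieldType) (A B : 'M[K]_2) : \det A = 1 -> \det B = 1 ->
  exists M : 'M[{poly K}]_2, [/\ \det M = 1, eval_mx 0 M = A & eval_mx 1 M = B].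
Proof.
move=> /SL2_elementary[v ->] /SL2_elementary[v' ->].
pose V i : {poly K} := (v i)%:P + 'X * (v' i - v i)%:P.
have ev t : eval_mx t (elementary_word V) = elementary_word (fun i => (V i).[t]).
  rewrite /elementary_word !mx2M /eval_mx.
  by apply: mx2_eqP; rewrite !mxE /= /horner_eval !(hornerD, hornerM, hornerC).
exists (elementary_word V); split.
- rewrite /elementary_word !det_mulmx !det_mx2E; ring.
- by rewrite ev; congr elementary_word; apply/funext => i; rewrite /V !hornerE.
- rewrite ev; congr elementary_word; apply/funext => i.
  by rewrite /V hornerD hornerM !hornerC hornerX mul1r addrC subrK.
Qed.

Lemma poly_eval_eq0 (P : {poly rat}) : (forall t, P.[t] = 0) -> P = 0.
Proof.
move=> P0; apply: (@roots_geq_poly_eq0 _ _ [seq i%:R | i <- iota 0 (size P)]).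
- by apply/allP => t _; rewrite /root P0.
- by rewrite map_inj_uniq ?iota_uniq // => i j /eqP; rewrite eqr_nat => /eqP.
- by rewrite size_map size_iota.
Qed.

End PathConnected.

Section RepresentationVariety.
Local Open Scope ring_scope.
Variables (G : groupType) (n : nat) (alpha : 'I_n -> G).
Hypothesis alpha_free : free_family alpha.
Variables (H : G -> Prop).
Hypothesis H1 : H 1%g.
Hypothesis HM : forall x y, H x -> H y -> H (x * y)%g.
Hypothesis H_spanned : forall x, H x -> spanned alpha x.
Variables (CT : finType) (col : G -> CT).
Hypothesis colP : forall x y, col x = col y <-> H (x / y)%g.
Variables (J : finType) (gam : J -> G).
Hypothesis gamH : forall j, H (gam j).
Hypothesis gam_gen : forall h, H h -> exists w : seq J, h = (\prod_(j <- w) gam j)%g.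
Variables (phi : G -> G).
Hypothesis phiM : {morph phi : x y / (x * y)%g}.
Hypothesis phiH : forall h, H h -> H (phi h).

(** Values outside [H] are left arbitrary: all that is ever evaluated is the
restriction to [H]. *)
Definition is_rep (rho : G -> 'M[rat]_2) : Prop :=
  [/\ rho 1%g = 1,
      {in [set h | H h]%classic &, {morph rho : x y / (x * y)%g >-> x * y}}
    & forall h, H h -> \det (rho h) = 1].

Definition rep : Type := {rho : G -> 'M[rat]_2 | is_rep rho}.

Lemma rep1 (r : rep) : sval r 1%g = 1. Proof. by case: r => rho []. Qed.

Lemma repM (r : rep) x y : H x -> H y -> sval r (x * y)%g = sval r x * sval r y.
Proof. by case: r => rho [] /= _ rM _ Hx Hy; apply: rM; rewrite inE. Qed.

Lemma rep_det (r : rep) h : H h -> \det (sval r h) = 1.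
Proof. by case: r => rho [] /= _ _; apply. Qed.

Lemma is_rep_pullback (r : rep) : is_rep (fun x => sval r (phi x)).
Proof.
split=> [|x y|h Hh]; first by rewrite morph_mulg1 ?rep1.
  by rewrite !inE => Hx Hy; rewrite phiM repM //; apply: phiH.
exact/rep_det/phiH.
Qed.

Definition rep_pullback (r : rep) : rep := exist _ _ (is_rep_pullback r).

Lemma rep_pullback_iter i (r : rep) x :
  sval (iter i rep_pullback r) x = sval r (iter i phi x).
Proof. by elim: i r x => // i IHi r x; rewrite iterS /= IHi -iterSr. Qed.

Definition coord_index : finType := (J * ('I_2 * 'I_2))%type.

Definition coord (q : 'I_#|coord_index|) (r : rep) : rat :=
  let j := enum_val q in sval r (gam j.1) j.2.1 j.2.2.

Lemma coordE j a b (r : rep) : coord (enum_rank (j, (a, b))) r = sval r (gam j) a b.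
Proof. by rewrite /coord enum_rankK. Qed.

Lemma rep_entry_poly h a b : H h -> polynomial_fun coord (fun r => sval r h a b).
Proof.
move=> /gam_gen[w ->]; elim: w a b => [|j w IHw] a b.
  by apply: poly_fun_ext (poly_fun_cst _ ((1 : 'M_2) a b)) => r; rewrite big_nil rep1.
have HP : H (\prod_(l <- w) gam l)%g by exact: H_prod.
apply: (@poly_fun_ext _ _ _ _ (fun r : rep =>
  \sum_l sval r (gam j) a l * sval r (\prod_(l <- w) gam l)%g l b)).
  by move=> r; rewrite big_cons repM // mxE.
apply: poly_fun_sum => l _; apply: poly_funM; last exact: IHw.
by apply: poly_fun_ext (poly_fun_coord _ (enum_rank (j, (a, l)))) => r; rewrite coordE.
Qed.

Lemma coord_pullback q : polynomial_fun coord (fun r => coord q (rep_pullback r)).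
Proof. exact/rep_entry_poly/phiH. Qed.

Section PathProduct.
Variables (S : nzRingType) (A : CT -> 'I_n * bool -> S).
Hypothesis AV : forall g l,
  A (col g) l * A (col (g * wval alpha [:: l])%g) (inv_letter l) = 1.

(** The product of the labels met along the path from the coset of [g] that spells
the word; edges of the coset graph carry labels in [S]. *)
Fixpoint path_prod (g : G) (w : word 'I_n) : S :=
  if w is l :: w' then A (col g) l * path_prod (g * wval alpha [:: l])%g w' else 1.

Lemma path_prod_cat g u v :
  path_prod g (u ++ v) = path_prod g u * path_prod (g * wval alpha u)%g v.
Proof.
elim: u g => [|l u IHu] g /=; first by rewrite mul1r wval_nil mulg1.
by rewrite IHu mulrA -mulgA -wval_cat.
Qed.

Lemma path_prod_col g g' w : col g = col g' -> path_prod g w = path_prod g' w.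
Proof.
elim: w g g' => //= l w IHw g g' e; rewrite e; congr (_ * _).
by apply: IHw; apply: (col_mulr colP).
Qed.

Lemma path_prod_wval g w w' :
  wval alpha w = wval alpha w' -> path_prod g w = path_prod g w'.
Proof.
apply: free_family_invariant => // u l v.
rewrite !path_prod_cat; congr (_ * _) => /=.
by rewrite mulrA AV mul1r wval_letterV mulgK.
Qed.

Definition path_rep (x : G) : S := path_prod 1%g (word_of alpha x).

(** Paths spelling elements of [H] are loops at the base coset. *)
Lemma path_repM x y : H x -> H y -> path_rep (x * y)%g = path_rep x * path_rep y.
Proof.
move=> Hx Hy; have sx := H_spanned Hx; have sy := H_spanned Hy.
rewrite /path_rep (@path_prod_wval _ _ (word_of alpha x ++ word_of alpha y)).
  rewrite path_prod_cat word_ofK // mul1g; congr (_ * _).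
  by apply: path_prod_col; apply: (col_H colP).
by rewrite wval_cat !word_ofK //; apply: H_spanned; apply: HM.
Qed.

Lemma path_rep1 : path_rep 1%g = 1.
Proof.
rewrite /path_rep (@path_prod_wval _ _ [::]) // word_ofK ?wval_nil //.
exact: H_spanned.
Qed.

End PathProduct.

Lemma adj_inv (R : comNzRingType) (M N : 'M[R]_2) :
  \det M = 1 -> M * N = 1 -> \adj M = N.
Proof.
move=> detM MN; rewrite -[LHS]mulr1 -MN mulrA.
by rewrite (_ : \adj M * M = 1) ?mul1r // [LHS]mul_adj_mx detM.
Qed.

(** Every representation arises from a labelling, the edge from [t] by [a] being
labelled by the value of its Schreier generator. Since [alpha] is free, every
labelling defines a representation, so labels can be joined edge by edge in
[SL2]. *)
Lemma rep_path (r0 r1 : rep) : exists P : G -> 'M[{poly rat}]_2,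
  (forall t, is_rep (fun h => eval_mx t (P h))) /\
  (forall h, H h -> eval_mx 0 (P h) = sval r0 h /\ eval_mx 1 (P h) = sval r1 h).
Proof.
pose s t a := schreier col (coset_rep col t) (alpha a).
have sH t a : H (s t a) by apply: (schreierH colP).
have /choice[lab labP] (ta : CT * 'I_n) : exists M : 'M[{poly rat}]_2,
    [/\ \det M = 1, eval_mx 0 M = sval r0 (s ta.1 ta.2)
      & eval_mx 1 M = sval r1 (s ta.1 ta.2)].
  by apply: SL2_path; apply: rep_det.
pose source t a := col (coset_rep col t / alpha a)%g.
(* An edge crossed backwards carries the inverse of its label, which is the
   adjugate. *)
pose A t (l : 'I_n * bool) :=
  if l.2 then \adj (lab (source t l.1, l.1)) else lab (t, l.1).
have sourceE g a : source (col g) a = col (g / alpha a)%g.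
  by apply: (col_mulr colP); apply: col_rep.
have AV g l : A (col g) l * A (col (g * wval alpha [:: l])%g) (inv_letter l) = 1.
  case: l => a []; rewrite /A /= wval_cons wval_nil mulg1 /=.
    by rewrite sourceE [LHS]mul_adj_mx; have [->] := labP (col (g / alpha a)%g, a).
  rewrite sourceE mulgK [LHS]mul_mx_adj; by have [->] := labP (col g, a).
have A_det t l : \det (A t l) = 1.
  rewrite /A; case: ifP => _; last by case: (labP (t, l.1)).
  have [d _ _] := labP (source t l.1, l.1).
  by rewrite -[LHS]mul1r -{1}d -det_mulmx mul_mx_adj d det1.
have evM t : {morph (@eval_mx rat 2 t) : x y / x * y} by move=> x y; apply: map_mxM.
have ev1 t : eval_mx t (1 : 'M[{poly rat}]_2) = 1 by apply: map_mx1.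
have ev_path t (r : rep) : (forall ta, eval_mx t (lab ta) = sval r (s ta.1 ta.2)) ->
    forall h, H h -> eval_mx t (path_rep A h) = sval r h.
  move=> labr.
  have letterP g l :
      eval_mx t (A (col g) l) = sval r (schreier col g (wval alpha [:: l])).
    have posP g' a : eval_mx t (lab (col g', a)) = sval r (schreier col g' (alpha a)).
      by rewrite labr /s /=; congr (sval r); apply: (schreier_col colP); apply: col_rep.
    case: l => a []; rewrite /A /= wval_cons wval_nil mulg1 //=.
    rewrite sourceE /eval_mx map_mx_adj -/(eval_mx t _) posP.
    apply: adj_inv; first by apply: rep_det; apply: (schreierH colP).
    rewrite -repM; try exact: (schreierH colP).
    have -> : schreier col g (alpha a)^-1 =
              schreier col (g / alpha a * alpha a) (alpha a)^-1.
      by rewrite mulgVK.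
    by rewrite -(schreierM) mulgV schreier_g1 rep1.
  have pathP g w : eval_mx t (path_prod A g w) = sval r (schreier col g (wval alpha w)).
    elim: w g => [|l w IHw] g /=; first by rewrite wval_nil schreier_g1 rep1.
    rewrite evM letterP IHw -repM; try exact: (schreierH colP).
    by rewrite -schreierM -wval_cat.
  move=> h Hh; rewrite /path_rep pathP word_ofK; last exact: H_spanned.
  by rewrite (schreier_1h colP) //.
exists (path_rep A); split=> [t|h Hh]; last first.
  by split; apply: ev_path => // ta; case: (labP ta).
split=> [|x y|h Hh].
- by rewrite path_rep1 // ev1.
- by rewrite !inE => Hx Hy; rewrite path_repM // evM.
- have det_path g w : \det (path_prod A g w) = 1.
    elim: w g => [|l w IHw] g /=; first exact: det1.
    by rewrite det_mulmx A_det IHw mul1r.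
  by rewrite /eval_mx det_map_mx det_path rmorph1.
Qed.

(** Restricted to a polynomial path joining a point where [f] is nonzero to one
where [g] is nonzero, [f] and [g] become nonzero polynomials in one variable. *)
Lemma rep_irreducible (f g : rep -> rat) :
  polynomial_fun coord f -> polynomial_fun coord g ->
  (forall r, f r * g r = 0) -> (forall r, f r = 0) \/ (forall r, g r = 0).
Proof.
move=> fP gP fg; apply: contrapT => /not_orP[/existsNP[r0 f0] /existsNP[r1 g1]].
have [P [P_rep P01]] := rep_path r0 r1.
pose path t : rep := exist _ _ (P_rep t).
have along F : polynomial_fun coord F ->
    exists Q : {poly rat}, forall t, Q.[t] = F (path t).
  move=> [D [c Fc]].
  exists (\sum_(m : {ffun 'I_#|coord_index| -> 'I_D}) (c m)%:P *
    \prod_q (P (gam (enum_val q).1) (enum_val q).2.1 (enum_val q).2.2) ^+ m q).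
  move=> t; rewrite Fc horner_sum; apply: eq_bigr => m _.
  rewrite hornerM hornerC horner_prod; congr (_ * _); apply: eq_bigr => q _.
  by rewrite horner_exp /coord /= mxE.
have ends F r t : polynomial_fun coord F ->
    (forall h, H h -> eval_mx t (P h) = sval r h) -> F (path t) = F r.
  move=> [D [c Fc]] tr; rewrite !Fc; apply: eq_bigr => m _; congr (_ * _).
  by apply: eq_bigr => q _; rewrite /coord /= tr.
have [Qf QfP] := along _ fP; have [Qg QgP] := along _ gP.
have /eqP : Qf * Qg = 0.
  by apply: poly_eval_eq0 => t; rewrite hornerM QfP QgP.
rewrite mulf_eq0 => /orP[/eqP Q0|/eqP Q0].
- by apply: f0; rewrite -(ends f r0 0) // -?QfP ?Q0 ?horner0 // => h /P01[].
- by apply: g1; rewrite -(ends g r1 1) // -?QgP ?Q0 ?horner0 // => h /P01[].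
Qed.

(** Specialize the free family of polynomial matrices at a rational parameter where
the matrix of [x] is not the identity. *)
Lemma rep_faithful x : H x -> x <> 1%g -> exists r : rep, sval r x <> 1.
Proof.
move=> Hx x1; pose c := fun i : 'I_n => (2 * i)%:R : rat.
have c_inj : injective (slope c).
  case=> i b [j b']; rewrite /slope /c /= -!natrD => /eqP.
  rewrite eqr_nat => /eqP e.
  have ebb : b = b' by move: e; case: b; case: b' => /=; lia.
  by move: e; rewrite ebb => e; congr pair; apply/val_inj => /=; lia.
pose rho := free_rep alpha (letter_mx c).
have rhoM g h : H g -> H h -> rho (g * h)%g = rho g * rho h.
  by move=> /H_spanned Fg /H_spanned Fh; apply: free_repM => //; apply: letter_mxV.
have rho1 : rho 1%g = 1 by apply: free_rep1 => //; apply: letter_mxV.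
have rho_neq := letter_rep_faithful alpha_free c_inj (H_spanned Hx) x1.
have [t rho_t] : exists t, eval_mx t (rho x) <> 1.
  apply: contrapT => nex; apply: rho_neq; apply/matrixP => a b; apply/eqP.
  rewrite -subr_eq0; apply/eqP/poly_eval_eq0 => t.
  have /matrixP/(_ a b) : eval_mx t (rho x) = 1.
    by apply: contrapT => h; apply: nex; exists t.
  rewrite [LHS]mxE /horner_eval => e; rewrite hornerD hornerN e !mxE.
  by case: (a == b); rewrite !hornerE ?subrr.
have rep_t : is_rep (fun h => eval_mx t (rho h)).
  split=> [|y z|h Hh]; first by rewrite rho1 /eval_mx map_mx1.
    by rewrite !inE => Hy Hz; rewrite rhoM // /eval_mx -[RHS]map_mxM.
  rewrite /eval_mx det_map_mx /rho /free_rep (_ : \det _ = 1) ?rmorph1 //.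
  elim: word_of => [|l w IHw]; first by rewrite big_nil det1.
  by rewrite big_cons det_mulmx IHw det_letter_mx mulr1.
by exists (exist _ _ rep_t).
Qed.

(** That [phi^i h] is trivial means that the functions [r |-> r h - 1] vanish on the
[i]-th image of the representation variety. *)
Lemma kernel_stable i h : H h ->
  iter i phi h = 1%g -> iter #|coord_index| phi h = 1%g.
Proof.
move=> Hh hi; have iterH m : H (iter m phi h) by elim: m => //= m; apply: phiH.
apply: contrapT => /(rep_faithful (iterH _))[r]; apply; apply/matrixP => a b.
pose f (r : rep) := sval r h a b + - (1 : 'M[rat]_2) a b.
have fP : polynomial_fun coord f.
  by apply: poly_funD; [exact: rep_entry_poly | exact: poly_fun_cst].
have inh : inhabited rep by constructor.
have fi r' : f (iter i rep_pullback r') = 0.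
  by rewrite /f rep_pullback_iter hi rep1 subrr.
have := vanish_stable coord_pullback rep_irreducible inh fP fi r.
by rewrite /f rep_pullback_iter => /eqP; rewrite subr_eq0 => /eqP.
Qed.

End RepresentationVariety.

(** * The bound *)

(** In the notation of the introduction, [generator_bound] bounds [d] and
[orbit_bound] is [4 d + 2 L], with [L] the factorial of [idempotence_bound]. *)
Definition coset_bound (n m : nat) := m ^ (n + m).
Definition generator_bound (n m : nat) :=
  m ^ (2 * (coset_bound n m)`!) * ((n + m) * 2).
Definition idempotence_bound (n m : nat) :=
  coset_bound n m + ((2 ^ generator_bound n m) ^ generator_bound n m +
                     (3 ^ generator_bound n m) ^ generator_bound n m).
Definition orbit_bound (n m : nat) :=
  generator_bound n m * 4 + (idempotence_bound n m)`! + (idempotence_bound n m)`!.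

Lemma computable_orbit_bound :
  computable (fun x : 7.-tuple nat =>
    orbit_bound (tnth x ord0) (tnth x (lift ord0 ord0))).
Proof.
rewrite /orbit_bound /idempotence_bound /generator_bound /coset_bound.
by repeat first [exact: computable_proj | exact: computable_cst
  | apply: computableD | apply: computableM | apply: computableX
  | apply: computable_fact].
Qed.

Section VirtuallyFree.
Local Open Scope group_scope.
Variables (n m : nat) (D : vf_data n m) (G : groupType).
Variables (alpha : 'I_n -> G) (beta : 'I_m -> G).
Variable phi : {multiplicative G -> G}.
Hypothesis descD : describes D alpha beta.

Let F : G -> Prop := spanned alpha.

Let F1 : F 1. Proof. by exists [::] => //; rewrite wval_nil. Qed.

Let FM x y : F x -> F y -> F (x * y).
Proof. by move=> [w _ <-] [w' _ <-]; exists (w ++ w') => //; rewrite wval_cat. Qed.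

Let FV x : F x -> F x^-1.
Proof. by move=> [w _ <-]; exists (inv_word w) => //; rewrite wval_inv_word. Qed.

Let FVr x y : F (x / y) -> F (y / x).
Proof. by move=> /FV; rewrite invgF. Qed.

Let F_trans x y z : F (x / y) -> F (y / z) -> F (x / z).
Proof. by move=> xy yz; rewrite -(divgKA y); apply: FM. Qed.

Let F_divM x x' y y' : F (x / x') -> F (y / y') -> F (x * y / (x' * y')).
Proof.
move=> xx' /(desc_normal descD x^-1); rewrite conjgE invgK => yy'.
have -> : x * y / (x' * y') = x * (y / y' / x) * (x / x').
  by rewrite invgM !mulgA !mulgVK.
exact: FM.
Qed.

Let F_divV x y : F (x / y) -> F (x^-1 / y^-1).
Proof.
move=> xy; have -> : x^-1 / y^-1 = (y / x) ^ y.
  by rewrite conjgE invgK !mulgA mulVg mul1g.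
exact/(desc_normal descD)/FVr.
Qed.

Lemma coset_index_exists : exists cl : G -> 'I_m, forall x y, cl x = cl y <-> F (x / y).
Proof.
have /choice[cl clP] (x : G) : exists i, exists2 f, F f & f * beta i = x.
  have : [set: G]%classic x by [].
  by rewrite -(desc_cover descD) => -[i _ [f Ff <-]]; exists i, f.
exists cl => x y; have [f Ff fx] := clP x; have [g Fg gy] := clP y.
split=> [xy|Fxy].
  by rewrite -fx -gy xy mulgKA; apply: FM => //; apply: FV.
apply: (desc_disjoint descD) => //; exists x; split; first by exists f.
by exists (x / y * g); [exact: FM | rewrite -mulgA gy mulgVK].
Qed.

Let phi1 : phi 1 = 1.
Proof. by apply: morph_mulg1; apply: gmulfM. Qed.

Let phiV x : phi x^-1 = (phi x)^-1.
Proof. by apply: (@mulIg _ (phi x)); rewrite -gmulfM !mulVg phi1. Qed.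

Let iterM i : {morph iter i phi : x y / x * y}.
Proof. by move=> x y; elim: i => //= i ->; rewrite gmulfM. Qed.

Let iter1 i : iter i phi 1 = 1.
Proof. by elim: i => //= i ->; rewrite phi1. Qed.

Let iterV i x : iter i phi x^-1 = (iter i phi x)^-1.
Proof. by elim: i => //= i ->; rewrite phiV. Qed.

Let iterF i x y : iter i phi (x / y) = iter i phi x / iter i phi y.
Proof. by rewrite iterM iterV. Qed.

(** Since [F] is normal, the map from [x] to the coset of [phi^i x] is a
homomorphism to a quotient, so it is determined by the cosets of the images of
the generators. *)
Lemma coset_iterates (B : nat) : (coset_bound n m <= B)%N ->
  forall j x, F (iter (B`! + j) phi x / iter (B`! + (B`! + j)) phi x).
Proof.
move=> B_ge j; have [cl clP] := coset_index_exists.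
pose code i := [ffun a => cl (iter i phi (gens alpha beta a))].
pose R i j := forall x, F (iter i phi x / iter j phi x).
apply: (@shift_pigeonhole _ code R B).
- by move=> a b c ab bc x; apply: F_trans (ab x) (bc x).
- by move=> a b ab x; rewrite !iterSr.
- move=> a b ab x; have [w <-] := (desc_pres descD).1 x.
  elim: w => [|[y s] w IHw]; first by rewrite wval_nil !iter1 divg1.
  rewrite wval_cons !iterM; apply: F_divM => //.
  have Fy : F (iter a phi (gens alpha beta y) / iter b phi (gens alpha beta y)).
    by apply/clP; have /ffunP/(_ y) := ab; rewrite !ffunE.
  by case: s => //=; rewrite !iterV; apply: F_divV.
- by rewrite card_ffun card_sum !card_ord.
Qed.

Let H (g : G) : Prop := forall i, F (iter i phi g).

Let H1 : H 1. Proof. by move=> i; rewrite iter1. Qed.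
Let HM x y : H x -> H y -> H (x * y).
Proof. by move=> Hx Hy i; rewrite iterM; apply: FM. Qed.
Let HV x : H x -> H x^-1.
Proof. by move=> Hx i; rewrite iterV; apply: FV. Qed.
Let phiH h : H h -> H (phi h).
Proof. by move=> Hh i; rewrite -iterSr. Qed.
Let H_spanned h : H h -> spanned alpha h. Proof. exact: (fun Hh => Hh 0%N). Qed.

Let CT : finType := {ffun 'I_(2 * (coset_bound n m)`!) -> 'I_m}.

(** By [coset_iterates] for [B = coset_bound n m], the cosets of the iterates of
index at least [2 * B`!] repeat earlier ones, so finitely many iterates decide
membership in [H]. *)
Lemma coloring_exists : exists col : G -> CT, forall x y, col x = col y <-> H (x / y).
Proof.
have [cl clP] := coset_index_exists.
exists (fun x => [ffun i : 'I__ => cl (iter i phi x)]) => x y.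
split=> [/ffunP e i|Hxy]; last first.
  by apply/ffunP => i; rewrite !ffunE; apply/clP; rewrite -iterF.
have [b] := ubnP i; elim: b i => // b IHb i ib.
set L := (coset_bound n m)`! in e *.
case: (ltnP i (2 * L)) => iL.
  by have := e (Ordinal iL); rewrite !ffunE => /clP; rewrite iterF.
have per z : F (iter (i - L) phi z / iter i phi z).
  have := coset_iterates (leqnn _) (i - 2 * L) z; rewrite -/L.
  have -> : (L + (L + (i - 2 * L)) = i)%N by lia.
  by have -> : (L + (i - 2 * L) = i - L)%N by lia.
have iL' : F (iter (i - L) phi (x / y)).
  by apply: IHb; have := fact_gt0 (coset_bound n m); rewrite -/L; lia.
rewrite iterF; apply: F_trans (FVr (per x)) _.
by apply: F_trans (per y); rewrite -iterF.
Qed.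

Let J : finType := (CT * (('I_n + 'I_m) * bool))%type.

Let card_J : #|J| = generator_bound n m.
Proof. by rewrite !card_prod card_sum card_bool card_ffun !card_ord. Qed.

Lemma generators_exist : exists gam : J -> G,
  (forall j, H (gam j)) /\
  (forall h, H h -> exists w : seq J, h = \prod_(j <- w) gam j).
Proof.
have [col colP] := coloring_exists.
exists (schreier_gen col (gens alpha beta)); split=> [j|h].
  exact: (schreierH colP).
by apply: (schreier_generate colP); apply: (desc_pres descD).1.
Qed.

Let L := (idempotence_bound n m)`!.
Let psi := iter L phi.

Let psi_coset x : H (psi (psi x) / psi x).
Proof.
move=> i; rewrite iterF /psi -!iterD; apply: FVr.
have -> : (i + L + L = L + (L + i))%N by lia.
rewrite (addnC i L); apply: coset_iterates; apply: leq_addr.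
Qed.

Let psiH h : H h -> H (psi h).
Proof. by move=> Hh; rewrite /psi; elim: L => //= i; apply: phiH. Qed.

Lemma prime_power_period p x r :
  prime p -> ((p ^ #|J|) ^ #|J| <= idempotence_bound n m)%N ->
  (0 < r)%N -> iter r psi x = x -> exists a, iter (p ^ a) psi x = x.
Proof.
move=> p_pr pB r0 xr; have [gam [gamH gam_gen]] := generators_exist.
have p_char : p \in [pchar {poly 'F_p}]%R by rewrite pchar_poly pchar_Fp.
apply: (@period_power _ H {poly 'F_p} psi _ psiH _ _ p r x) => //.
- exact: iterM.
- by move=> y; exists (psi (psi y) / psi y) => //; rewrite mulgVK.
- move=> h Hh; rewrite /psi -iterD.
  apply: (deg1_eq_iter H1 HM gamH gam_gen _ _ _ phiH pB Hh).
  + exact: prime_gt0.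
  + exact: pcharf0.
  + exact: gmulfM.
- exact: (degree_lt_separation (desc_free descD) H1 HM HV H_spanned).
Qed.

(** The period divides both a power of two and a power of three. *)
Lemma periodic_period x r : (0 < r)%N -> iter r phi x = x -> psi x = x.
Proof.
move=> r0 xr.
have xr' : iter r psi x = x.
  have -> : iter r psi x = iter (L * r) phi x.
    by rewrite mulnC; elim: (r) => // i IHi; rewrite iterS IHi mulSn iterD.
  by elim: (L) => // i IHi; rewrite mulSn iterD IHi.
have [a xa] : exists a, iter (2 ^ a) psi x = x.
  apply: prime_power_period r0 xr' => //; rewrite card_J /idempotence_bound; lia.
have [b xb] : exists b, iter (3 ^ b) psi x = x.
  apply: prime_power_period r0 xr' => //; rewrite card_J /idempotence_bound; lia.
have iter_mul c i : iter c psi x = x -> iter (i * c) psi x = x.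
  by move=> xc; elim: i => // i IHi; rewrite mulSn iterD IHi.
have [u v uv _] := egcdnP (3 ^ b) (expn_gt0 2 a : (0 < 2 ^ a)%N).
have cop : gcdn (2 ^ a) (3 ^ b) = 1%N.
  by apply/eqP; apply: coprimeXl; apply: coprimeXr.
have := iter_mul _ u xa; rewrite uv cop addn1 iterS iter_mul //.
Qed.

Lemma EvPer_iterates x : EvPer phi x ->
  iter (generator_bound n m * 4 + L + L) phi x =
  iter (generator_bound n m * 4 + L) phi x.
Proof.
move=> xev; have [j [r [r0 xjr]]] := EvPer_collision xev.
have jL : iter (j + L) phi x = iter j phi x.
  by rewrite addnC iterD; apply: (periodic_period r0); rewrite -iterD addnC.
have [gam [gamH gam_gen]] := generators_exist.
have [col colP] := coloring_exists.
have phiM : {morph phi : y z / y * z} by exact: gmulfM.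
have jh : iter j phi (psi (psi x) / psi x) = 1.
  rewrite iterF /psi -!iterD; have -> : iter (j + L + L) phi x = iter (j + L) phi x.
    by rewrite addnC iterD jL -iterD addnC.
  by rewrite mulgV.
have := kernel_stable (desc_free descD) H1 HM H_spanned colP gamH gam_gen phiM
  phiH (psi_coset x) jh.
have -> : #|coord_index J| = (generator_bound n m * 4)%N.
  by rewrite card_prod card_J card_prod !card_ord.
by rewrite iterF /psi -!iterD => /divg1_eq.
Qed.

Lemma orbit_bounded : exists2 M, is_max_orbit phi M & (M <= orbit_bound n m)%N.
Proof.
apply: (@is_max_orbit_exists _ _ _ 1); first exact: phi1.
by move=> x xev; apply: card_Orb_le (EvPer_iterates xev); apply: fact_gt0.
Qed.

End VirtuallyFree.

Theorem corollary5p6 :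
  exists c : recfn 7,
    forall (n m : nat) (D : vf_data n m) (E : endo_data n m)
           (G : groupType) (alpha : 'I_n -> G) (beta : 'I_m -> G)
           (phi : {multiplicative G -> G}),
      describes D alpha beta -> describes_endo E alpha beta phi ->
      exists k : nat, computes c (input D E) k /\
        exists2 M : nat, is_max_orbit phi M & (M <= k)%N.
Proof.
have [c cP] := computable_orbit_bound.
exists c => n m D E G alpha beta phi descD _.
exists (orbit_bound n m); split; last exact: orbit_bounded descD.
exact: (cP (input D E)).
Qed.
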